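(* Let $\{p_j\}_{j\ge1}$ be the enumeration in increasing order of the prime numbers, and let $\{X_j\}_{j\ge1}$ be independent random variables with $\mathbb{P}(X_j=0)=\frac{p_j}{1+p_j}$ and $\mathbb{P}(X_j=1)=\frac1{1+p_j}$. Let $S_n=\frac1{\log(p_n)}\sum_{j=1}^nX_j\log(p_j)$, and for $n\ge3$ let $$\Delta_n=\frac{\log\log(n)}{\log(n)}.$$ Then there exists $C>0$ such that (for all $n\ge3$) $$\mathcal{W}_3(S_n,Z)\le C\,\Delta_n\sqrt{-\log(\Delta_n)},$$ where $Z$ follows the Dickman distribution ($\theta=1$). In particular, $$\mathcal{W}_3(S_n,Z)=\mathcal{O}\left(\frac{(\log\log n)^{3/2}}{\log n}\right).$$
   Context: The Dickman distribution ($\theta=1$) is the law of $Z$ with characteristic function $\mathbb{E}[e^{itZ}]=\exp\left(\int_0^1\frac{e^{itx}-1}{x}\,dx\right)$, $t\in\mathbb{R}$. $\mathcal{W}_3(X,Y)=\sup|\mathbb{E}[h(X)]-\mathbb{E}[h(Y)]|$ over $h\in\mathcal{C}^3(\mathbb{R})$ with $\|h^{(k)}\|_\infty\le1$ for $0\le k\le3$. *)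

(* Defs.v *)
(* MathComp-Analysis; complex numbers from mathcomp-real-closed *)
From HB Require Import structures.
From mathcomp Require Import all_boot all_order all_algebra finmap.
From mathcomp Require Import complex.
From mathcomp Require Import all_classical all_reals all_analysis.

Set Implicit Arguments.
Unset Strict Implicit.
Unset Printing Implicit Defensive.

Import Order.TTheory GRing.Theory Num.Theory.
Import numFieldNormedType.Exports.

Local Open Scope classical_set_scope.
Local Open Scope ring_scope.
Local Open Scope complex_scope.

Definition Cexp (R : realType) (z : R[i]) : R[i] :=
  (expR (complex.Re z) * cos (complex.Im z))
  +i* (expR (complex.Re z) * sin (complex.Im z)).

Definition Cintegral d (T : measurableType d) (R : realType)
    (mu : {measure set T -> \bar R}) (D : set T) (f : T -> R[i]) : R[i] :=
  (\int[mu]_(x in D) complex.Re (f x)) +i* (\int[mu]_(x in D) complex.Im (f x)).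

Definition char_fun d (T : measurableType d) (R : realType)
    (P : probability T R) (X : T -> R) (t : R) : R[i] :=
  Cintegral P setT (fun w => Cexp ('i * (t * X w)%:C)).

(* The integrand takes the value 0 at x = 0, since 0^-1 = 0; this has no effect
   on the integral. *)
Definition dickman d (T : measurableType d) (R : realType)
    (P : probability T R) (Z : {RV P >-> R}) : Prop :=
  forall t : R, char_fun P Z t =
    Cexp (Cintegral (@lebesgue_measure R) `[0%R, 1%R]
            (fun x : R => (Cexp ('i * (t * x)%:C) - 1) / x%:C)).

Definition sup_norm (R : realType) (f : R -> R) : \bar R :=
  ereal_sup (range (fun x => `|f x|%:E)).

Definition continuously_differentiable (R : realType) (n : nat) (h : R -> R) :
    Prop :=
  (forall k, (k < n)%N -> forall x, derivable (h^`(k)%classic) x 1) /\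
  continuous (h^`(n)%classic).

Definition W3_test (R : realType) : set (R -> R) :=
  [set h | continuously_differentiable 3 h /\
           forall k, (k <= 3)%N -> (sup_norm (h^`(k)%classic) <= 1)%E].

(* X and Y may live on different probability spaces: only their laws matter.
   For random variables the value lies in [0, 2], the test functions being
   bounded by 1. *)
Definition W3 d d' (T : measurableType d) (T' : measurableType d')
    (R : realType) (P : probability T R) (Q : probability T' R)
    (X : T -> R) (Y : T' -> R) : \bar R :=
  ereal_sup [set `|'E_P[h \o X] - 'E_Q[h \o Y]|%E | h in @W3_test R].

Definition mutually_independent d (T : measurableType d) (R : realType)
    (P : probability T R) (D : set nat) (X : nat -> {RV P >-> R}) : Prop :=
  forall (J : {fset nat}) (B : nat -> set R),
    [set` J] `<=` D ->
    (forall j, j \in J -> measurable (B j)) ->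
    P (\bigcap_(j in [set` J]) (X j @^-1` B j)) =
    (\prod_(j <- J) P (X j @^-1` B j))%E.

(* Indices start at 1; the value p 0 is irrelevant. *)
Definition prime_enumeration (p : nat -> nat) : Prop :=
  (forall i j, (0 < i)%N -> (i < j)%N -> (p i < p j)%N) /\
  (forall q, prime q <-> exists2 j, (0 < j)%N & p j = q).

Definition prime_sum (T : Type) (R : realType) (p : nat -> nat)
    (X : nat -> T -> R) (n : nat) (w : T) : R :=
  (ln (p n)%:R)^-1 * \sum_(1 <= j < n.+1) X j w * ln (p j)%:R.

Definition Delta (R : realType) (n : nat) : R := ln (ln n%:R) / ln n%:R.

(* Main.v *)
Require Import Defs.
From HB Require Import structures.
From mathcomp Require Import all_boot all_order all_algebra finmap.
From mathcomp Require Import complex.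
From mathcomp Require Import all_classical all_reals all_analysis.
From mathcomp Require Import measurable_realfun.
From mathcomp Require Import ring lra.

(** The sum [S] over the primes is compared to the Dickman variable [Z] without
    Fourier inversion. If [U] is uniform on the unit interval and independent of
    [Z], then [U (Z + 1)] has the law of [Z]. Let [A h] be the function
    [x |-> mean of h (U (x + 1))], called [dickman_mean] below. The means of [h Z]
    and [A h Z] are equal, and [A] halves the derivative of [h] and the Lipschitz
    constant of that derivative. So if the means of [h S] and [A h S] differ by at
    most [eps] times these constants, then iterating [A] shows that the means of
    [h S] and [h Z] differ by at most [2 eps] times them ([dickman_contraction]).

    The identity for [Z] ([dickman_fixed_point]) is read on characteristic
    functions: the explicit one of the Dickman law satisfies
    [(t phi(t))' = exp(it) phi(t)]. This uses that the characteristic function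
    determines the law ([char_fun_unique]), which is obtained by approximating
    [h (N sin (x / N))] by its Bernstein polynomials in [sin (x / N)], which are
    trigonometric polynomials.

    The estimate for [S] is Stein's method ([dickman_mean_stein_bound]). With
    [f] the derivative of [x |-> mean of h (U x)], the difference [h x - A h x] is
    [x f x] minus the integral of [f] over [[x, x + 1]]. Independence turns the mean
    of [S f S] into that of the sum of [q_i a_i f (S + a_i)], up to the sum of the
    [(q_i a_i)^2], where [a_i = log p_i / log p_n] and [q_i = 1 / (1 + p_i)]. Mertens'
    first theorem ([mertens_first]) says that the masses [q_i a_i] at the points
    [a_i] approximate the Lebesgue measure of the unit interval: their distribution
    function is off by at most [5 / log p_n]. Summation by parts ([abel_riemann])
    concludes that [eps] is of order [1 / log p_n].

    Hence the distance is at most [27 / log n] ([W3_prime_sum_le]), and both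
    claims follow: [- log Delta_n >= 1] because [y exp(-y) <= exp(-1)], while
    [log log n] is bounded below for [n >= 3] and tends to infinity. *)

Set Implicit Arguments.
Unset Strict Implicit.
Unset Printing Implicit Defensive.

Import Order.TTheory GRing.Theory Num.Theory.
Import numFieldNormedType.Exports.

Local Open Scope classical_set_scope.
Local Open Scope ring_scope.

(** * Calculus on the unit interval *)

Lemma bounded_integrable d (T : measurableType d) (R : realType)
    (mu : {measure set T -> \bar R}) (A : set T) (f : T -> R) (M : R) :
  measurable A -> (mu A < +oo)%E -> measurable_fun A f ->
  (forall x, A x -> `|f x| <= M) -> mu.-integrable A (EFin \o f).
Proof.
move=> mA muA mf fM; apply: measurable_bounded_integrable => //.
exists M; split; first exact: num_real.
by move=> r Mr x Ax; exact: (le_trans (fM x Ax) (ltW Mr)).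
Qed.

Lemma lipschitz_continuous (R : realType) (f : R -> R) (L : R) :
  (forall x y, `|f x - f y| <= L * `|x - y|) -> continuous f.
Proof.
move=> fL x; apply/cvgrPdist_le => e e0.
have L1 : 0 < `|L| + 1 by rewrite ltr_wpDl.
near=> y; apply: (le_trans (fL x y)).
apply: (@le_trans _ _ ((`|L| + 1) * `|x - y|)).
  by rewrite ler_wpM2r// (le_trans (ler_norm _))// lerDl.
rewrite mulrC -ler_pdivlMr//; near: y.
by apply: cvgr_dist_le => //; rewrite divr_gt0.
Unshelve. all: by end_near. Qed.

(** Remainders bounded by the square of the increment survive integration, so
    deriving from such a bound makes differentiation under the integral sign
    elementary. *)
Lemma is_derive_quadratic (R : realType) (F : R -> R) (x D c : R) :
  (forall e, `|F (x + e) - F x - e * D| <= c * e ^+ 2) -> is_derive x 1 F D.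
Proof.
move=> FD.
suff H : (fun h => h^-1 *: (F (h *: 1 + x) - F x)) @ 0^' --> D.
  by split; [apply/cvg_ex; exists D|exact: cvg_lim H].
apply/cvgrPdist_le => e e0; near=> h.
have h0 : h != 0 by near: h; exact: nbhs_dnbhs_neq.
rewrite -[h *: 1]/(h * 1) mulr1 -[_ *: _]/(_ * _) distrC.
have -> : h^-1 * (F (h + x) - F x) - D = h^-1 * (F (x + h) - F x - h * D).
  by rewrite (addrC h x); field.
rewrite normrM normfV ler_pdivrMl ?normr_gt0//.
apply: (le_trans (FD h)).
rewrite -real_normK ?num_real// expr2 mulrA mulrC ler_wpM2l//.
have c1 : 0 < `|c| + 1 by rewrite ltr_wpDl.
apply: (@le_trans _ _ ((`|c| + 1) * `|h|)).
  by rewrite ler_wpM2r// (le_trans (ler_norm _))// lerDl.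
rewrite mulrC -ler_pdivlMr//; near: h.
apply: dnbhs0_le; exact: divr_gt0.
Unshelve. all: by end_near. Qed.

Lemma is_derive_continuous (R : realType) (f df : R -> R) :
  (forall x : R, is_derive x 1 f (df x)) -> continuous f.
Proof.
move=> fd x; apply: differentiable_continuous; apply/derivable1_diffP.
by case: (fd x).
Qed.

Lemma MVT_unordered (R : realType) (f df : R -> R) (a b : R) :
  (forall x : R, is_derive x 1 f (df x)) ->
  exists2 c, `|c - a| <= `|b - a| & f b - f a = df c * (b - a).
Proof.
move=> fd.
have cf : continuous f := is_derive_continuous fd.
have [ab|ba] := leP a b.
  have [c cab ->] := @MVT_segment R f df a b ab (fun x _ => fd x) (continuous_subspaceT cf).
  exists c => //; move: cab; rewrite in_itv/= => /andP[ac cb].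
  by rewrite !ger0_norm ?subr_ge0// lerB.
have [c cab E] := @MVT_segment R f df b a (ltW ba) (fun x _ => fd x) (continuous_subspaceT cf).
exists c; last by rewrite -opprB E -mulrN opprB.
move: cab; rewrite in_itv/= => /andP[ac cb].
by rewrite !(distrC _ a) !ger0_norm ?subr_ge0// ?lerB// ltW.
Qed.

Lemma lipschitz_of_derive (R : realType) (f df : R -> R) (L : R) :
  (forall x : R, is_derive x 1 f (df x)) -> (forall x, `|df x| <= L) ->
  forall x y, `|f x - f y| <= L * `|x - y|.
Proof.
move=> fd dfL x y; have [c _ ->] := MVT_unordered y x fd.
by rewrite normrM ler_wpM2r.
Qed.

Lemma taylor1_lipschitz (R : realType) (f df : R -> R) (L : R) :
  (forall x : R, is_derive x 1 f (df x)) ->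
  (forall x y, `|df x - df y| <= L * `|x - y|) ->
  forall x y, `|f y - f x - (y - x) * df x| <= L * (y - x) ^+ 2.
Proof.
move=> fd dfL x y.
have L0 : 0 <= L by have := dfL 1 0; rewrite subr0 normr1 mulr1; apply: le_trans.
have [c cx ->] := MVT_unordered x y fd.
rewrite mulrC -mulrBr normrM -real_normK ?num_real// expr2 mulrCA ler_wpM2l//.
by apply: (le_trans (dfL c x)); rewrite ler_wpM2l.
Qed.

Definition integral01 (R : realType) (f : R -> R) : R :=
  \int[@lebesgue_measure R]_(u in `[0%R, 1%R]) f u.

Section unit_interval.
Context {R : realType}.
Implicit Types f g : R -> R.
Local Notation I := (`[(0 : R), (1 : R)]%classic).
Local Notation mu := (@lebesgue_measure R).
Local Notation integrable01 f := (mu.-integrable I (EFin \o f)).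

Lemma lebesgue01 : mu I = 1%E.
Proof. by rewrite lebesgue_measure_itv/= lte_fin ltr01 oppr0 adde0. Qed.

Lemma integrable01_bounded f (M : R) : measurable_fun I f ->
  (forall u : R, 0 <= u <= 1 -> `|f u| <= M) -> integrable01 f.
Proof.
move=> mf fM; apply: (@bounded_integrable _ _ _ _ _ _ M) => //.
by rewrite [ltLHS]lebesgue01 ltry.
Qed.

Lemma integrable01_continuous f : continuous f -> integrable01 f.
Proof.
move=> cf; apply: continuous_compact_integrable; first exact: segment_compact.
exact: continuous_subspaceT.
Qed.

Lemma integral01_cst (r : R) : integral01 (cst r) = r.
Proof. by rewrite /integral01 Rintegral_cst// [X in fine X]lebesgue01 /= mulr1. Qed.

(** The bound is asked away from 0 only: some integrands below are quotients by
    the variable, whose value at 0 is a convention. *)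
Lemma integral01_bound f (M : R) : integrable01 f ->
  (forall u : R, 0 < u <= 1 -> `|f u| <= M) -> `|integral01 f| <= M.
Proof.
move=> intf fM.
have sub : `](0 : R), (1 : R)]%classic `<=` I by exact: subset_itv_oc_cc.
have intf0 : mu.-integrable `](0 : R), (1 : R)]%classic (EFin \o f).
  by apply: (@integrableS _ _ _ mu I).
have intM := integrable01_continuous (@cst_continuous _ _ M).
have intM0 : mu.-integrable `](0 : R), (1 : R)]%classic (EFin \o cst M).
  by apply: (@integrableS _ _ _ mu I).
rewrite /integral01 -Rintegral_itv_obnd_cbnd//.
rewrite (le_trans (le_normr_Rintegral _ _))//.
rewrite -[leRHS]integral01_cst /integral01 -Rintegral_itv_obnd_cbnd//.
by apply: le_Rintegral => //; exact: integrable_norm.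
Qed.

Lemma integral01_derive (g g1 : R -> R -> R) (c t : R) :
  (forall s, integrable01 (g s)) -> integrable01 (g1 t) ->
  (forall (s u : R), 0 < u <= 1 ->
     `|g s u - g t u - (s - t) * g1 t u| <= c * (s - t) ^+ 2) ->
  is_derive t 1 (fun s => integral01 (g s)) (integral01 (g1 t)).
Proof.
move=> ig ig1 gg1; apply: (@is_derive_quadratic _ _ _ _ c) => e.
have ige : integrable01 (fun u => e * g1 t u).
  by have := @integrableZl _ _ _ mu I (measurable_itv _) e _ ig1.
have igB : integrable01 (fun u => g (t + e) u - g t u).
  by have := @integrableB _ _ _ mu I (measurable_itv _) _ _ (ig (t + e)) (ig t).
rewrite /integral01 -RintegralZl// -RintegralB// -RintegralB//.
apply: integral01_bound.
  by have := @integrableB _ _ _ mu I (measurable_itv _) _ _ igB ige.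
by move=> u u01; have := gg1 (t + e) u u01; rewrite (addrC t) addrK.
Qed.

(** The integrand is, up to the factor [t], the derivative in [u] of [G (u * t)].
    Stated with a product, the identity also covers [t = 0]. *)
Lemma integral01_FTC (G G1 : R -> R) (t : R) :
  (forall x : R, is_derive x 1 G (G1 x)) -> continuous G1 ->
  t * integral01 (fun u => G1 (u * t)) = G t - G 0.
Proof.
move=> Gd cG1.
have cut : continuous (fun u : R => u * t) by move=> u; exact: mulrr_continuous.
have cG1t : continuous (fun u : R => G1 (u * t)).
  by move=> u; apply: continuous_comp; [exact: cut|exact: cG1].
rewrite /integral01 -RintegralZl//; last exact: integrable01_continuous.
pose F (u : R) := G (u * t).
have Fd (u : R) : is_derive u 1 F (t * G1 (u * t)).
  have H : is_derive u 1 (fun u : R => u * t) t.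
    rewrite [X in is_derive _ _ _ X](_ : t = u *: 0 + t *: 1); last first.
      by rewrite scaler0 add0r -[_ *: _]/(_ * _) mulr1.
    exact: is_deriveM.
  by rewrite mulrC; exact: is_derive1_comp.
rewrite /Rintegral (@continuous_FTC2 _ _ F)//.
- by rewrite /F mul1r mul0r.
- apply: continuous_subspaceT => u; apply: continuousM; first exact: cst_continuous.
  exact: cG1t.
- have cF : continuous F := is_derive_continuous Fd.
  split; first by move=> x _; case: (Fd x).
    by apply: cvg_at_right_filter; exact: cF.
  by apply: cvg_at_left_filter; exact: cF.
- by move=> u _; rewrite derive1E; case: (Fd u).
Qed.

End unit_interval.

(** * The averaging operator of the Dickman law *)

(** One constant [L] bounds both the derivative and its Lipschitz constant: the
    averaging operator below halves both, which is the only quantitative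
    information that the argument follows. The derivative is an argument so that
    its image under the operator can be written down. *)
Definition smooth_test (R : realType) (M L : R) (h h1 : R -> R) : Prop :=
  [/\ forall x, `|h x| <= M, forall x : R, is_derive x 1 h (h1 x),
      forall x, `|h1 x| <= L & forall x y, `|h1 x - h1 y| <= L * `|x - y|].

(** The mean of [h (U x)] for [U] uniform on the unit interval. *)
Definition dilation_mean (R : realType) (h : R -> R) (x : R) : R :=
  integral01 (fun u => h (u * x)).

(** The derivative of [dilation_mean h], when [h1] is that of [h]. *)
Definition dilation_mean' (R : realType) (h1 : R -> R) (x : R) : R :=
  integral01 (fun u => u * h1 (u * x)).

Section smooth_test.
Context {R : realType}.
Implicit Types h f g : R -> R.
Local Notation mu := (@lebesgue_measure R).
Local Notation I := (`[(0 : R), (1 : R)]%classic).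

Lemma smooth_test_continuous (M L : R) h h1 :
  smooth_test M L h h1 -> continuous h /\ continuous h1.
Proof.
move=> [_ hd _ h1L]; split; first exact: is_derive_continuous hd.
exact: lipschitz_continuous h1L.
Qed.

Lemma continuous_dilation h (x : R) :
  continuous h -> continuous (fun u : R => h (u * x)).
Proof.
move=> ch u; apply: continuous_comp; [exact: mulrr_continuous|exact: ch].
Qed.

Lemma continuous_weighted_dilation h (x : R) :
  continuous h -> continuous (fun u : R => u * h (u * x)).
Proof.
by move=> ch u; apply: continuousM; [exact: cvg_id|exact: continuous_dilation].
Qed.

Lemma eq_integral01 f g : f =1 g -> integral01 f = integral01 g.
Proof. by move=> /funext->. Qed.

Lemma integral01_id : integral01 (@id R) = 2^-1.
Proof.
have sd (x : R) : is_derive x 1 (fun x : R => 2^-1 * x ^+ 2) x.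
  apply: (@is_derive_quadratic _ _ _ _ 2^-1) => e.
  rewrite (_ : _ - _ - _ = 2^-1 * e ^+ 2); last by field.
  by rewrite ger0_norm// mulr_ge0 ?sqr_ge0// invr_ge0.
have cid : continuous (@id R) by move=> x; exact: cvg_id.
have := integral01_FTC 1 sd cid.
rewrite mul1r (@eq_integral01 _ id) => [->|x]; last by rewrite mulr1.
by rewrite expr1n expr0n/= mulr1 mulr0 subr0.
Qed.

Lemma integral01_bound_linear f (M : R) : continuous f ->
  (forall u : R, 0 <= u <= 1 -> `|f u| <= M * u) -> `|integral01 f| <= M / 2.
Proof.
move=> cf fM.
rewrite (le_trans (le_normr_Rintegral _ _))//; first exact: integrable01_continuous.
have cid : continuous (@id R) by move=> x; exact: cvg_id.
have iid := integrable01_continuous cid.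
rewrite -integral01_id /integral01 -RintegralZl//.
apply: le_Rintegral => //.
- exact/integrable_norm/integrable01_continuous.
- exact: (@integrableZl _ _ _ mu I (measurable_itv _) M _ iid).
Qed.

(** Differentiating [h (u x)] in [x] brings out a factor [u], and the mean of [u]
    over the unit interval is one half. *)
Lemma smooth_test_dilation_mean (M L : R) h h1 : smooth_test M L h h1 ->
  smooth_test M (L / 2) (dilation_mean h) (dilation_mean' h1).
Proof.
move=> st; have [ch ch1] := smooth_test_continuous st.
case: st => hM hd h1L h1lip.
have L0 : 0 <= L := le_trans (normr_ge0 _) (h1L 0).
split.
- move=> x; apply: integral01_bound => //.
  exact/integrable01_continuous/continuous_dilation.
- move=> x.
  apply: (@integral01_derive _ (fun s u => h (u * s)) (fun s u => u * h1 (u * s)) L).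
  + by move=> s; exact/integrable01_continuous/continuous_dilation.
  + exact/integrable01_continuous/continuous_weighted_dilation.
  + move=> s u /andP[/ltW u0 u1].
    have := taylor1_lipschitz hd h1lip (u * x) (u * s).
    rewrite -mulrBr (mulrC u (s - x)) -(mulrA (s - x)) => /le_trans; apply.
    rewrite ler_wpM2l// exprMn ler_piMr ?sqr_ge0//.
    by rewrite expr_le1.
- move=> x; apply: integral01_bound_linear.
    exact: continuous_weighted_dilation.
  by move=> u /andP[u0 _]; rewrite normrM ger0_norm// mulrC ler_wpM2r.
- move=> x y; rewrite /dilation_mean'.
  have cw (z : R) : continuous (fun u : R => u * h1 (u * z)).
    exact: continuous_weighted_dilation.
  have cB : continuous (fun u : R => u * h1 (u * x) - u * h1 (u * y)).
    by move=> u; apply: (continuousB (cw x u) (cw y u)).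
  rewrite /integral01 -RintegralB//; last 2 first.
  + exact: integrable01_continuous (cw x).
  + exact: integrable01_continuous (cw y).
  rewrite mulrAC; apply: integral01_bound_linear.
    exact: cB.
  move=> u /andP[u0 u1]; rewrite -mulrBr normrM ger0_norm// mulrC ler_wpM2r//.
  apply: (le_trans (h1lip _ _)); rewrite -mulrBr normrM ger0_norm//.
  by rewrite ler_wpM2l// ler_piMl.
Qed.

(** The integral over [0, 1] of the derivative of [u |-> u * h (u * x)]. This is
    Stein's equation in disguise: with [f = dilation_mean' h1], it exhibits
    [h x - dilation_mean h (x + 1)] as [x f x] minus the integral of [f] over
    [[x, x + 1]]. *)
Lemma dilation_mean_stein (M L : R) h h1 (x : R) : smooth_test M L h h1 ->
  h x = dilation_mean h x + x * dilation_mean' h1 x.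
Proof.
move=> st; have [ch ch1] := smooth_test_continuous st.
case: st => _ hd _ _.
pose G1 (u : R) := h (u * x) + x * (u * h1 (u * x)).
have Gd (u : R) : is_derive u 1 (fun v : R => v * h (v * x)) (G1 u).
  have Hx : is_derive u 1 (fun u : R => u * x) x.
    rewrite [X in is_derive _ _ _ X](_ : x = u *: 0 + x *: 1); last first.
      by rewrite scaler0 add0r -[_ *: _]/(_ * _) mulr1.
    exact: is_deriveM.
  have Hh : is_derive u 1 (fun v : R => h (v * x)) (x * h1 (u * x)).
    by rewrite mulrC; exact: is_derive1_comp.
  rewrite [X in is_derive _ _ _ X](_ : _ = u *: (x * h1 (u * x)) + h (u * x) *: 1).
    exact: is_deriveM.
  by rewrite -![_ *: _]/(_ * _) mulr1 addrC mulrCA.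
have cG : continuous (fun u : R => x * (u * h1 (u * x))).
  move=> u; apply: cvgM; first exact: cvg_cst.
  exact: (@continuous_weighted_dilation h1 x ch1).
have cG1 : continuous G1.
  by move=> u; apply: cvgD; [exact: (@continuous_dilation h x ch)|exact: cG].
have := integral01_FTC 1 Gd cG1; rewrite !mul1r mul0r subr0 => <-.
rewrite (@eq_integral01 _ G1) => [|u]; last by rewrite mulr1.
rewrite /integral01 RintegralD//.
- rewrite RintegralZl//.
  exact/integrable01_continuous/continuous_weighted_dilation.
- exact/integrable01_continuous/continuous_dilation.
- exact: integrable01_continuous.
Qed.

(** The mean of [h (U (x + 1))] for [U] uniform. The Dickman law is the law of
    [Z] for which [U (Z + 1)], with [U] independent of [Z], has the law of [Z]. *)
Definition dickman_mean (h : R -> R) (x : R) : R := dilation_mean h (x + 1).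
Definition dickman_mean' (h1 : R -> R) (x : R) : R := dilation_mean' h1 (x + 1).

Lemma smooth_test_dickman_mean (M L : R) h h1 : smooth_test M L h h1 ->
  smooth_test M (L / 2) (dickman_mean h) (dickman_mean' h1).
Proof.
move=> /smooth_test_dilation_mean[hM hd h1L h1lip]; split.
- by move=> x; exact: hM.
- move=> x; rewrite /dickman_mean /dickman_mean' -[X in is_derive _ _ _ X]mulr1.
  have H : is_derive x 1 (fun x : R => x + 1) 1.
    by rewrite -[X in is_derive _ _ _ X]addr0; exact: is_deriveD.
  exact: is_derive1_comp.
- by move=> x; exact: h1L.
- by move=> x y; apply: (le_trans (h1lip _ _)); rewrite opprD addrACA subrr addr0.
Qed.

End smooth_test.

(** * Means of functions of weighted Bernoulli sums *)

(** The mean of [F] at the sum of independent variables that take the value [a]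
    with probability [q] and 0 otherwise, for [(q, a)] in [l], computed by
    conditioning on the first variable. The same recursion gives the mean of
    the sum over the primes and the Bernstein polynomials. *)
Fixpoint bernoulli_mean (R : realType) (l : seq (R * R)) (F : R -> R) : R :=
  if l is (q, a) :: l' then
    (1 - q) * bernoulli_mean l' F + q * bernoulli_mean l' (fun x => F (x + a))
  else F 0.

Definition is_prob (R : realType) (q : R) : bool := 0 <= q <= 1.

Section bernoulli_mean.
Context {R : realType}.
Implicit Types (l : seq (R * R)) (F G f : R -> R) (q a : R).
Local Notation prob_weights l := (all (fun qa : R * R => is_prob qa.1) l).

Lemma bernoulli_meanD l F G :
  bernoulli_mean l (fun x => F x + G x) = bernoulli_mean l F + bernoulli_mean l G.
Proof. by elim: l F G => [//|[q a] l IH] F G /=; rewrite !IH; ring. Qed.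

Lemma bernoulli_meanZ l (c : R) F :
  bernoulli_mean l (fun x => c * F x) = c * bernoulli_mean l F.
Proof. by elim: l F => [//|[q a] l IH] F /=; rewrite !IH; ring. Qed.

Lemma bernoulli_meanB l F G :
  bernoulli_mean l (fun x => F x - G x) = bernoulli_mean l F - bernoulli_mean l G.
Proof. by elim: l F G => [//|[q a] l IH] F G /=; rewrite !IH; ring. Qed.

Lemma bernoulli_mean_cst l (c : R) : bernoulli_mean l (fun=> c) = c.
Proof. by elim: l => [//|[q a] l IH] /=; rewrite IH; ring. Qed.

Lemma bernoulli_mean_sum (T : Type) (s : seq T) l (F : T -> R -> R) :
  bernoulli_mean l (fun x => \sum_(i <- s) F i x) =
  \sum_(i <- s) bernoulli_mean l (F i).
Proof.
elim: s => [|i s IH].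
  rewrite big_nil -[RHS](bernoulli_mean_cst l 0).
  by congr bernoulli_mean; apply/funext => x; rewrite big_nil.
rewrite big_cons -IH -bernoulli_meanD.
by congr bernoulli_mean; apply/funext => x; rewrite big_cons.
Qed.

Lemma le_bernoulli_mean l F G : prob_weights l -> (forall x, F x <= G x) ->
  bernoulli_mean l F <= bernoulli_mean l G.
Proof.
elim: l F G => [|[q a] l IH] F G //= /andP[/andP[q0 q1] ql] FG.
by rewrite lerD// ler_wpM2l ?subr_ge0//; apply: IH => // x; exact: FG.
Qed.

Lemma ler_norm_bernoulli_mean l F G : prob_weights l ->
  (forall x, `|F x| <= G x) -> `|bernoulli_mean l F| <= bernoulli_mean l G.
Proof.
move=> ql FG; rewrite ler_norml -mulN1r -bernoulli_meanZ.
apply/andP; split; apply: le_bernoulli_mean => // x;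
  by have := FG x; rewrite ler_norml ?mulN1r => /andP[].
Qed.

Lemma bernoulli_mean_bound l F (M : R) : prob_weights l ->
  (forall x, `|F x| <= M) -> `|bernoulli_mean l F| <= M.
Proof.
by move=> ql FM; rewrite -(bernoulli_mean_cst l M); exact: ler_norm_bernoulli_mean.
Qed.

(** In the mean of [S * f S], the variable of weight [a] contributes [q * a] times
    the mean of [f (S' + a)], where [S'] is the sum of the others. Putting that
    variable back into [S'] moves the argument by [a] with probability [q], at a
    cost of at most [L * (q * a) ^+ 2]. *)
Lemma bernoulli_mean_stein l f (L : R) : prob_weights l ->
  (forall x y, `|f x - f y| <= L * `|x - y|) ->
  `|bernoulli_mean l (fun x => x * f x) -
    \sum_(qa <- l) qa.1 * qa.2 * bernoulli_mean l (fun x => f (x + qa.2))|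
  <= L * \sum_(qa <- l) (qa.1 * qa.2) ^+ 2.
Proof.
elim: l f => [|[q a] l IH] f /=.
  by rewrite !big_nil mul0r mulr0 subrr normr0.
move=> /andP[/andP[q0 q1] ql] fL.
rewrite !big_cons/=.
pose fa x := f (x + a).
have faL x y : `|fa x - fa y| <= L * `|x - y|.
  by apply: (le_trans (fL _ _)); rewrite opprD addrACA subrr addr0.
pose D g := bernoulli_mean l (fun x => x * g x) -
  \sum_(qa <- l) qa.1 * qa.2 * bernoulli_mean l (fun x => g (x + qa.2)).
have Ef : `|D f| <= L * \sum_(qa <- l) (qa.1 * qa.2) ^+ 2 := IH f ql fL.
have Efa : `|D fa| <= L * \sum_(qa <- l) (qa.1 * qa.2) ^+ 2 := IH fa ql faL.
(* Replacing the sum without the first variable by the full sum in the term of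
   the first variable costs r. *)
pose r := (q * a) * (q * (bernoulli_mean l fa - bernoulli_mean l (fun x => fa (x + a)))).
rewrite [X in `|X|](_ : _ = (1 - q) * D f + q * D fa + r); last first.
  rewrite /D /r.
  have -> : bernoulli_mean l (fun x => (x + a) * f (x + a)) =
      bernoulli_mean l (fun x => x * fa x) + a * bernoulli_mean l fa.
    rewrite -bernoulli_meanZ -bernoulli_meanD; congr bernoulli_mean.
    by apply/funext => x; rewrite mulrDl.
  have -> : \sum_(qa <- l) qa.1 * qa.2 *
      ((1 - q) * bernoulli_mean l (fun x => f (x + qa.2)) +
       q * bernoulli_mean l (fun x => f (x + a + qa.2))) =
    (1 - q) * (\sum_(qa <- l) qa.1 * qa.2 * bernoulli_mean l (fun x => f (x + qa.2)))
    + q * (\sum_(qa <- l) qa.1 * qa.2 * bernoulli_mean l (fun x => fa (x + qa.2))).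
    rewrite !mulr_sumr -big_split/=; apply: eq_bigr => i _.
    have -> : (fun x => f (x + a + i.2)) = (fun x => fa (x + i.2)).
      by apply/funext => x; rewrite /fa addrAC.
    ring.
  rewrite -/fa; have -> : (fun x => f (x + a + a)) = (fun x => fa (x + a)) by [].
  by rewrite -/fa; ring.
have rL : `|r| <= L * (q * a) ^+ 2.
  rewrite /r !normrM (ger0_norm q0) -bernoulli_meanB.
  have /(bernoulli_mean_bound ql) H x : `|fa x - fa (x + a)| <= L * `|a|.
    by apply: (le_trans (faL _ _)); rewrite opprD addrA subrr add0r normrN.
  apply: (@le_trans _ _ (q * `|a| * (q * (L * `|a|)))).
    by rewrite ler_wpM2l ?mulr_ge0// ler_wpM2l.
  by rewrite -(real_normK (num_real (q * a))) normrM (ger0_norm q0) le_eqVlt;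
    apply/orP; left; apply/eqP; ring.
rewrite [leRHS]mulrDr [leRHS]addrC (le_trans (ler_normD _ _))// lerD//.
rewrite (le_trans (ler_normD _ _))// !normrM (ger0_norm q0) ger0_norm ?subr_ge0//.
set B := L * _ in Ef Efa *.
rewrite -[leRHS](_ : (1 - q) * B + q * B = _); last by ring.
by rewrite lerD// ler_wpM2l// subr_ge0.
Qed.

(** The second moment of a binomial variable around an arbitrary centre. *)
Lemma bernoulli_mean_sqr (n : nat) (y a c : R) :
  bernoulli_mean (nseq n (y, a)) (fun x => (x + c) ^+ 2) =
  (c + n%:R * a * y) ^+ 2 + n%:R * a ^+ 2 * y * (1 - y).
Proof.
elim: n c => [|n IH] c /=; first by rewrite add0r !mul0r !addr0.
rewrite IH.
have -> : (fun x => (x + a + c) ^+ 2) = (fun x => (x + (a + c)) ^+ 2).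
  by apply/funext => x; rewrite addrA.
by rewrite IH -natr1; ring.
Qed.

(** The error of the Bernstein polynomial of degree [(m + 1) ^ 2] of a Lipschitz
    function: the standard deviation of the sample mean is at most
    [1 / (2 (m + 1))]. *)
Lemma bernoulli_mean_concentration (m : nat) (y : R) g (L : R) : is_prob y ->
  (forall x z, `|g x - g z| <= L * `|x - z|) ->
  `|bernoulli_mean (nseq (m.+1 ^ 2) (y, (m.+1%:R ^+ 2)^-1)) g - g y| <= L / m.+1%:R.
Proof.
move=> y01 gL; set M : R := m.+1%:R; set l := nseq _ _.
have M0 : 0 < M by rewrite /M ltr0n.
have ql : prob_weights l.
  by apply/allP => x /nseqP[-> _].
have L0 : 0 <= L by have := gL 1 0; rewrite subr0 normr1 mulr1; apply: le_trans.
rewrite -{1}(bernoulli_mean_cst l (g y)) -bernoulli_meanB.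
(* By the inequality of arithmetic and geometric means, G dominates
   L * |x - y|; its mean only involves the variance. *)
pose G x := L / 2 * M^-1 + L / 2 * M * (x + - y) ^+ 2.
apply: (@le_trans _ _ (bernoulli_mean l G)).
  apply: ler_norm_bernoulli_mean => // x; apply: (le_trans (gL x y)).
  rewrite -subr_ge0 /G -(@real_normK _ (x - y)) ?num_real//.
  rewrite (_ : _ - _ = L / 2 * M * (M^-1 - `|x - y|) ^+ 2); last first.
    by field; rewrite gt_eqF.
  by rewrite mulr_ge0 ?sqr_ge0// mulr_ge0 ?divr_ge0// ltW.
rewrite bernoulli_meanD bernoulli_mean_cst bernoulli_meanZ /l bernoulli_mean_sqr.
have -> : (m.+1 ^ 2)%:R = M ^+ 2 by rewrite natrX.
have -> : - y + M ^+ 2 * (M ^+ 2)^-1 * y = 0.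
  by rewrite mulfV ?mul1r ?addNr// expf_neq0// gt_eqF.
have -> : 0 ^+ 2 + M ^+ 2 * (M ^+ 2)^-1 ^+ 2 * y * (1 - y) = M^-1 * (M^-1 * (y * (1 - y))).
  by field; rewrite gt_eqF.
rewrite (_ : L / 2 * M * _ = L / 2 * (M^-1 * (y * (1 - y)))); last first.
  by field; rewrite gt_eqF.
rewrite (_ : L / M = L / 2 * M^-1 + L / 2 * M^-1); last by field; rewrite gt_eqF.
rewrite lerD2l ler_wpM2l ?divr_ge0// ler_piMr ?invr_ge0 ?(ltW M0)//.
by case/andP: y01 => y0 y1; rewrite mulr_ile1// ?subr_ge0// lerBlDl lerDr.
Qed.

End bernoulli_mean.

(** * A law on the line is determined by its characteristic function *)

Definition mean d (T : measurableType d) (R : realType) (P : probability T R)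
  (f : T -> R) : R := \int[P]_w f w.

Section mean.
Context d (T : measurableType d) (R : realType) (P : probability T R).
Implicit Types f g : T -> R.

Lemma bounded_integrable_prob f (M : R) : measurable_fun setT f ->
  (forall w, `|f w| <= M) -> P.-integrable setT (EFin \o f).
Proof.
move=> mf fM; apply: (@bounded_integrable _ _ _ _ _ _ M) => //.
by rewrite [ltLHS]probability_setT ltry.
Qed.

Lemma mean_cst (c : R) : mean P (fun=> c) = c.
Proof. by rewrite /mean Rintegral_cst// [X in fine X]probability_setT mulr1. Qed.

Lemma meanD f g : P.-integrable setT (EFin \o f) ->
  P.-integrable setT (EFin \o g) ->
  mean P (fun w => f w + g w) = mean P f + mean P g.
Proof. by move=> fi gi; rewrite /mean RintegralD. Qed.

Lemma meanB f g : P.-integrable setT (EFin \o f) ->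
  P.-integrable setT (EFin \o g) ->
  mean P (fun w => f w - g w) = mean P f - mean P g.
Proof. by move=> fi gi; rewrite /mean RintegralB. Qed.

Lemma meanZ (c : R) f : P.-integrable setT (EFin \o f) ->
  mean P (fun w => c * f w) = c * mean P f.
Proof. by move=> fi; rewrite /mean RintegralZl. Qed.

Lemma mean_dist f g (e : R) :
  P.-integrable setT (EFin \o f) -> P.-integrable setT (EFin \o g) ->
  (forall w, `|f w - g w| <= e) -> `|mean P f - mean P g| <= e.
Proof.
move=> fi gi fg; rewrite -meanB//.
have fgi := integrableB measurableT fi gi.
rewrite (le_trans (le_normr_Rintegral measurableT fgi))// -[leRHS]mean_cst.
apply: le_Rintegral => //.
- exact: integrable_norm.
- apply: (@bounded_integrable_prob _ `|e|) => //; exact: measurable_cst.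
Qed.

Lemma bounded_mean_cvg (f_ : nat -> T -> R) f (M : R) :
  (forall n, measurable_fun setT (f_ n)) -> measurable_fun setT f ->
  (forall n w, `|f_ n w| <= M) -> (forall w, `|f w| <= M) ->
  (forall w, f_ ^~ w @ \oo --> f w) ->
  (fun n => mean P (f_ n)) @ \oo --> mean P f.
Proof.
move=> mf_ mf f_M fM ff.
have Mi : P.-integrable setT (EFin \o (fun=> M)).
  apply: (@bounded_integrable_prob _ `|M|) => //; exact: measurable_cst.
have H := @dominated_cvg _ _ _ P setT measurableT
  (fun n w => (f_ n w)%:E) (fun w => (f w)%:E) (EFin \o (fun=> M)) _ _ _ _ _.
have {}H : (\int[P]_x (f_ n x)%:E)%E @[n --> \oo] --> (\int[P]_x (f x)%:E)%E.
  apply: H => //.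
  - by move=> n; exact/measurable_EFinP.
  - by move=> w _; apply: cvg_EFin; [exact: nearW|exact: ff].
  - by move=> n w _; rewrite lee_fin.
have fi : P.-integrable setT (EFin \o f).
  exact: (@bounded_integrable_prob _ M).
apply: fine_cvg; rewrite fineK//.
exact: integrable_fin_num.
Qed.

End mean.

(** Given by generators, so that a property of means which is linear need only be
    checked on [cos (t * x)] and [sin (t * x)]. *)
Inductive trig_poly (R : realType) : (R -> R) -> Prop :=
| trig_cos (t : R) : trig_poly (fun x => cos (t * x))
| trig_sin (t : R) : trig_poly (fun x => sin (t * x))
| trig_add f g : trig_poly f -> trig_poly g -> trig_poly (fun x => f x + g x)
| trig_scale (c : R) f : trig_poly f -> trig_poly (fun x => c * f x).

Section uniqueness.
Context {R : realType}.
Implicit Types f g h : R -> R.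

Lemma trig_poly_measurable_bounded f : trig_poly f ->
  measurable_fun setT f /\ exists M, forall x, `|f x| <= M.
Proof.
elim=> {f} [t|t|f g _ [mf [M fM]] _ [mg [N gN]]|c f _ [mf [M fM]]].
- split; last by exists 1 => x; exact: cos_max.
  apply: continuous_measurable_fun => x; apply: continuous_comp.
    exact: mulrl_continuous.
  exact: continuous_cos.
- split; last by exists 1 => x; exact: sin_max.
  apply: continuous_measurable_fun => x; apply: continuous_comp.
    exact: mulrl_continuous.
  exact: continuous_sin.
- split; first exact: measurable_funD.
  by exists (M + N) => x; rewrite (le_trans (ler_normD _ _))// lerD.
- split; first exact: measurable_funM.
  by exists (`|c| * M) => x; rewrite normrM ler_wpM2l.
Qed.

Lemma trig_poly_cst (c : R) : trig_poly (fun=> c).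
Proof.
have := trig_scale c (trig_cos 0).
by under eq_fun do rewrite mul0r cos0 mulr1.
Qed.

(** The product-to-sum formulas. *)
Lemma trig_poly_mul_sin (s : R) f : trig_poly f ->
  trig_poly (fun x => sin (s * x) * f x).
Proof.
elim=> {f} [t|t|f g _ fs _ gs|c f _ fs].
- have := trig_scale 2^-1 (trig_add (trig_sin (s + t)) (trig_sin (s - t))).
  congr trig_poly; apply/funext => x.
  by rewrite mulrDl mulrBl sinD sinB; field.
- have := trig_scale 2^-1
    (trig_add (trig_cos (s - t)) (trig_scale (-1) (trig_cos (s + t)))).
  congr trig_poly; apply/funext => x.
  by rewrite mulrBl mulrDl cosB cosD; field.
- have := trig_add fs gs; congr trig_poly; apply/funext => x.
  by rewrite mulrDr.
- have := trig_scale c fs; congr trig_poly; apply/funext => x.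
  by rewrite mulrCA.
Qed.

(** The recursion that defines the Bernstein polynomials only multiplies by
    [(1 + sin (s * x)) / 2] and its complement to 1, hence stays within the
    trigonometric polynomials. *)
Lemma trig_poly_bernstein (s a : R) (n : nat) g :
  trig_poly (fun x => bernoulli_mean (nseq n ((1 + sin (s * x)) / 2, a)) g).
Proof.
elim: n g => [|n IH] g /=; first exact: trig_poly_cst.
pose B1 x := bernoulli_mean (nseq n ((1 + sin (s * x)) / 2, a)) g.
pose B2 x :=
  bernoulli_mean (nseq n ((1 + sin (s * x)) / 2, a)) (fun x => g (x + a)).
have t1 : trig_poly B1 := IH g.
have t2 : trig_poly B2 := IH (fun x => g (x + a)).
have := trig_scale 2^-1 (trig_add
  (trig_add t1 (trig_scale (-1) (trig_poly_mul_sin s t1)))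
  (trig_add t2 (trig_poly_mul_sin s t2))).
by congr trig_poly; apply/funext => x; rewrite -/(B1 x) -/(B2 x); field.
Qed.

Lemma cos_lipschitz (x y : R) : `|cos x - cos y| <= 1 * `|x - y|.
Proof.
apply: (@lipschitz_of_derive _ _ (fun x => - sin x)) => z.
by rewrite normrN; exact: sin_max.
Qed.

Lemma sin_lipschitz (x y : R) : `|sin x - sin y| <= 1 * `|x - y|.
Proof.
by apply: (@lipschitz_of_derive _ _ cos) => z; exact: cos_max.
Qed.

Lemma sin_quadratic (u : R) : `|sin u - u| <= u ^+ 2.
Proof.
have := taylor1_lipschitz (@is_derive_sin R) cos_lipschitz 0 u.
by rewrite sin0 cos0 !subr0 mulr1 mul1r.
Qed.

Section two_laws.
Context d d' (T : measurableType d) (T' : measurableType d')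
  (P : probability T R) (Q : probability T' R) (Y : T -> R) (Y' : T' -> R).
Hypothesis mY : measurable_fun setT Y.
Hypothesis mY' : measurable_fun setT Y'.
Hypothesis eq_cos : forall t,
  mean P (fun w => cos (t * Y w)) = mean Q (fun w => cos (t * Y' w)).
Hypothesis eq_sin : forall t,
  mean P (fun w => sin (t * Y w)) = mean Q (fun w => sin (t * Y' w)).

Lemma eq_mean_trig_poly f : trig_poly f -> mean P (f \o Y) = mean Q (f \o Y').
Proof.
have int f' : trig_poly f' -> P.-integrable setT (EFin \o (f' \o Y)) /\
    Q.-integrable setT (EFin \o (f' \o Y')).
  move=> /trig_poly_measurable_bounded[mf' [M f'M]].
  split; apply: (@bounded_integrable_prob _ _ _ _ _ M) => [|w]; try exact: f'M.
    exact: (measurableT_comp mf' mY).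
  exact: (measurableT_comp mf' mY').
elim=> {f} [t|t|f g tf IHf tg IHg|c f tf IHf].
- exact: eq_cos.
- exact: eq_sin.
- have [fP fQ] := int _ tf; have [gP gQ] := int _ tg.
  by rewrite /comp (meanD fP gP) (meanD fQ gQ); congr (_ + _).
- have [fP fQ] := int _ tf.
  by rewrite /comp (meanZ c fP) (meanZ c fQ); congr (_ * _).
Qed.

(** Bernstein's approximation in the variable [(1 + sin (s * x)) / 2], which ranges
    over [0, 1], is uniform and consists of trigonometric polynomials. *)
Lemma eq_mean_lipschitz_sin (s L M : R) g :
  (forall x y, `|g x - g y| <= L * `|x - y|) -> (forall x, `|g x| <= M) ->
  mean P (fun w => g ((1 + sin (s * Y w)) / 2)) =
  mean Q (fun w => g ((1 + sin (s * Y' w)) / 2)).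
Proof.
move=> gL gM; apply/eqP; rewrite -subr_eq0 -normr_le0; apply/ler_addgt0Pl => e e0.
rewrite addr0.
have L0 : 0 <= L by have := gL 1 0; rewrite subr0 normr1 mulr1; apply: le_trans.
have [m mL] : exists m, L / m.+1%:R <= e / 2.
  exists (Num.truncn (L / (e / 2))); rewrite ler_pdivrMr ?ltr0n//.
  rewrite mulrC -ler_pdivrMr ?divr_gt0//; exact/ltW/truncnS_gt.
pose b x := bernoulli_mean (nseq (m.+1 ^ 2)
  ((1 + sin (s * x)) / 2, (m.+1%:R ^+ 2)^-1)) g.
have tb : trig_poly b := trig_poly_bernstein _ _ _ _.
have bg x : `|g ((1 + sin (s * x)) / 2) - b x| <= e / 2.
  rewrite distrC (le_trans _ mL)// bernoulli_mean_concentration//.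
  by have := sin_max (s * x); rewrite ler_norml /is_prob; lra.
have [mb [N bN]] := trig_poly_measurable_bounded tb.
have mg : measurable_fun setT (fun x => g ((1 + sin (s * x)) / 2)).
  apply: measurableT_comp.
    by apply: continuous_measurable_fun; exact: lipschitz_continuous gL.
  apply: measurable_funM => //; apply: measurable_funD => //.
  exact: (trig_poly_measurable_bounded (trig_sin s)).1.
have close d1 (T1 : measurableType d1) (P1 : probability T1 R) (Y1 : T1 -> R) :
    measurable_fun setT Y1 ->
    `|mean P1 (fun w => g ((1 + sin (s * Y1 w)) / 2)) - mean P1 (b \o Y1)| <= e / 2.
  move=> mY1; apply: mean_dist => [| |w]; last exact: bg.
  - apply: (@bounded_integrable_prob _ _ _ _ _ M) => [|w //].
    exact: (measurableT_comp mg mY1).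
  - apply: (@bounded_integrable_prob _ _ _ _ _ N) => [|w]; last exact: bN.
    exact: (measurableT_comp mb mY1).
have := close _ _ P Y mY; have := close _ _ Q Y' mY'.
rewrite (eq_mean_trig_poly tb) distrC => H1 H2.
by rewrite (splitr e) (le_trans (ler_distD (mean Q (b \o Y')) _ _))// lerD.
Qed.

(** The function [h (N * sin (x / N))] is a continuous function of [sin (x / N)], so
    its means agree by the previous lemma, and it tends to [h x] boundedly as
    [N] grows. *)
Theorem char_fun_unique (L M : R) h :
  (forall x y, `|h x - h y| <= L * `|x - y|) -> (forall x, `|h x| <= M) ->
  mean P (h \o Y) = mean Q (h \o Y').
Proof.
move=> hL hM.
have L0 : 0 <= L by have := hL 1 0; rewrite subr0 normr1 mulr1; apply: le_trans.
pose N (n : nat) : R := n.+1%:R.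
have N0 n : 0 < N n by rewrite ltr0n.
pose hN n x := h (N n * sin ((N n)^-1 * x)).
have mh : measurable_fun setT h.
  by apply: continuous_measurable_fun; exact: lipschitz_continuous hL.
have mhN n : measurable_fun setT (hN n).
  apply: measurableT_comp => //; apply: measurable_funM => //.
  exact: (trig_poly_measurable_bounded (trig_sin (N n)^-1)).1.
have hN_cvg x : hN ^~ x @ \oo --> h x.
  apply/cvgrPdist_le => e e0; near=> n.
  rewrite distrC (le_trans (hL _ _))//.
  rewrite (_ : _ - x = N n * (sin ((N n)^-1 * x) - (N n)^-1 * x)); last first.
    by rewrite mulrBr; congr (_ - _); rewrite mulVKf ?gt_eqF.
  rewrite normrM gtr0_norm//.
  apply: (@le_trans _ _ (L * (N n * ((N n)^-1 * x) ^+ 2))).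
    by rewrite ler_wpM2l// ler_wpM2l ?sin_quadratic// ltW.
  rewrite (_ : L * _ = L * x ^+ 2 / N n); last by field; rewrite gt_eqF.
  rewrite ler_pdivrMr// -ler_pdivrMl//.
  apply/ltW/(lt_le_trans (truncnS_gt _)).
  rewrite ler_nat ltnS; near: n; exact: nbhs_infty_ge.
have cvg d1 (T1 : measurableType d1) (P1 : probability T1 R) (Y1 : T1 -> R) :
    measurable_fun setT Y1 ->
    (fun n => mean P1 (hN n \o Y1)) @ \oo --> mean P1 (h \o Y1).
  move=> mY1; apply: (@bounded_mean_cvg _ _ _ _ _ _ M).
  - by move=> n; exact: measurableT_comp.
  - exact: measurableT_comp.
  - by move=> n w; exact: hM.
  - by move=> w; exact: hM.
  - by move=> w; exact: hN_cvg.
have eqN n : mean P (hN n \o Y) = mean Q (hN n \o Y').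
  pose g v := h (N n * (2 * v - 1)).
  have gL x y : `|g x - g y| <= (L * (N n * 2)) * `|x - y|.
    apply: (le_trans (hL _ _)); rewrite -mulrBr opprB addrA subrK -mulrBr.
    by rewrite (mulrA (N n)) normrM ger0_norm ?mulr_ge0 ?(ltW (N0 n))// [leLHS]mulrA.
  have E (x : R) : g ((1 + sin ((N n)^-1 * x)) / 2) = hN n x.
    by rewrite /g /hN mulrCA mulfV// mulr1 addrAC subrr add0r.
  have -> : hN n = (fun x => g ((1 + sin ((N n)^-1 * x)) / 2)).
    by apply/funext => x; rewrite E.
  exact: (@eq_mean_lipschitz_sin (N n)^-1 _ M g gL (fun x => hM _)).
have := cvg _ _ P Y mY; have := cvg _ _ Q Y' mY'.
rewrite (_ : (fun n => mean P _) = (fun n => mean Q (hN n \o Y'))).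
  by move=> cQ cP; exact: (cvg_unique _ cP cQ).
by apply/funext => n; exact: eqN.
Unshelve. all: by end_near. Qed.

End two_laws.

End uniqueness.

(** * The Dickman law is a fixed point of the averaging operator *)

Section fubini_mean.
Context d1 d2 (T1 : measurableType d1) (T2 : measurableType d2) (R : realType).
Variables (P1 : probability T1 R) (P2 : probability T2 R).
Variables (F : T1 * T2 -> R) (M : R).
Hypothesis mF : measurable_fun setT F.
Hypothesis FM : forall z, `|F z| <= M.

Let intF : ((P1 \x P2)%E).-integrable setT (EFin \o F).
Proof. exact: (@bounded_integrable_prob _ _ _ _ _ M). Qed.

Lemma mean_prod1 :
  mean (P1 \x P2)%E F = mean P1 (fun x => mean P2 (fun y => F (x, y))).
Proof.
rewrite /mean /Rintegral -(integral12_prod_meas1 (f := EFin \o F))//.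
congr fine; apply: eq_integral => x _; rewrite fineK//.
apply: integrable_fin_num => //; apply: (@bounded_integrable_prob _ _ _ _ _ M) => //.
exact: measurableT_comp.
Qed.

Lemma mean_prod2 :
  mean (P1 \x P2)%E F = mean P2 (fun y => mean P1 (fun x => F (x, y))).
Proof.
rewrite /mean /Rintegral -(integral21_prod_meas1 (f := EFin \o F))//.
congr fine; apply: eq_integral => y _; rewrite fineK//.
apply: integrable_fin_num => //; apply: (@bounded_integrable_prob _ _ _ _ _ M) => //.
exact: measurableT_comp.
Qed.

End fubini_mean.

Section dickman_law.
Context {R : realType}.
Local Notation mu := (@lebesgue_measure R).
Local Notation I := (`[(0 : R), (1 : R)]%classic).
Local Notation U := (uniform_prob (@ltr01 R)).

(** The integral against the uniform law is computed for nonnegative functions;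
    adding the bound [M] reduces to that case. *)
Lemma mean_uniform (f : R -> R) (M : R) : measurable_fun setT f ->
  (forall x, `|f x| <= M) -> mean U f = integral01 f.
Proof.
move=> mf fM.
have fi : U.-integrable setT (EFin \o f) by exact: (@bounded_integrable_prob _ _ _ _ _ M).
have mM : measurable_fun setT (fun _ : R => M) by exact: measurable_cst.
have Mi : U.-integrable setT (EFin \o (fun=> M)).
  by apply: (@bounded_integrable_prob _ _ _ _ _ `|M|).
have : mean U (fun x => f x + M) = integral01 (fun x => f x + M).
  rewrite /mean /integral01 /Rintegral integral_uniform//.
  - by rewrite subr0 invr1 mul1e.
  - by apply/measurable_EFinP; exact: measurable_funD.
  - by move=> x; rewrite lee_fin -lerBlDr sub0r; have := fM x; rewrite ler_norml => /andP[].
rewrite (meanD fi Mi) mean_cst /integral01 RintegralD//; last 2 first.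
- by apply: (@integrable01_bounded _ _ M) => //; exact: measurable_funTS.
- exact: (integrable01_continuous (@cst_continuous _ _ M)).
by rewrite -/(integral01 (fun=> M)) integral01_cst => /addIr.
Qed.

Lemma integrable01_div (f : R -> R) (M : R) : continuous f ->
  (forall u : R, 0 <= u <= 1 -> `|f u / u| <= M) ->
  mu.-integrable I (EFin \o (fun u : R => f u / u)).
Proof.
move=> cf fM; apply: (@integrable01_bounded _ _ M) => //.
apply/measurable_fun_itv_obnd_cbndP.
apply: subspace_continuous_measurable_fun => //.
apply: continuous_in_subspaceT => u; rewrite inE/= in_itv/= => /andP[u0 _].
by apply: cvgM; [exact: cf|apply: cvgV; [rewrite gt_eqF|exact: cvg_id]].
Qed.

(** The characteristic function of the Dickman law is the exponential of
    [log_modulus t + i * phase t]. *)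
Definition log_modulus (t : R) : R := integral01 (fun u => (cos (u * t) - 1) / u).
Definition phase (t : R) : R := integral01 (fun u => sin (u * t) / u).

Lemma norm_div_le (x u M : R) : 0 <= M -> 0 <= u -> `|x| <= M * u ->
  `|x / u| <= M.
Proof.
move=> M0; rewrite le_eqVlt => /predU1P[<- _|u0 xM].
  by rewrite invr0 mulr0 normr0.
by rewrite normrM normfV (gtr0_norm u0) ler_pdivrMr.
Qed.

(** The derivative in [t] of the integrand [(cos (u * t) - 1) / u] no longer has the
    factor [1 / u]. *)
Lemma is_derive_log_modulus (t : R) :
  is_derive t 1 log_modulus (integral01 (fun u => - sin (u * t))).
Proof.
apply: (@integral01_derive _ (fun t u => (cos (u * t) - 1) / u)
  (fun t u => - sin (u * t)) 1).
- move=> s; apply: (@integrable01_div _ `|s|).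
    move=> u; apply: cvgB; last exact: cvg_cst.
    exact: (continuous_dilation (@continuous_cos R)).
  move=> u /andP[u0 _]; apply: norm_div_le => //.
  have := cos_lipschitz (u * s) 0; rewrite cos0 subr0 mul1r => /le_trans; apply.
  by rewrite normrM (ger0_norm u0) mulrC.
- apply: integrable01_continuous => u; apply: cvgN.
  exact: (continuous_dilation (@continuous_sin R)).
- move=> s u /andP[u0 u1].
  rewrite (_ : _ - _ = (cos (u * s) - cos (u * t) - (u * s - u * t) * - sin (u * t)) / u).
    have sN_lip (x y : R) : `|- sin x - - sin y| <= 1 * `|x - y|.
      by rewrite -opprD normrN; exact: sin_lipschitz.
    have := taylor1_lipschitz (@is_derive_cos R) sN_lip (u * t) (u * s).
    rewrite normrM normfV (gtr0_norm u0) ler_pdivrMr// => /le_trans; apply.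
    rewrite !mul1r -mulrBr exprMn mulrC ler_wpM2l ?sqr_ge0//.
    by rewrite expr2 ler_piMr// ltW.
  by field; rewrite gt_eqF.
Qed.

Lemma is_derive_phase (t : R) :
  is_derive t 1 phase (integral01 (fun u => cos (u * t))).
Proof.
apply: (@integral01_derive _ (fun t u => sin (u * t) / u)
  (fun t u => cos (u * t)) 1).
- move=> s; apply: (@integrable01_div _ `|s|).
    exact: (continuous_dilation (@continuous_sin R)).
  move=> u /andP[u0 _]; apply: norm_div_le => //.
  have := sin_lipschitz (u * s) 0; rewrite sin0 !subr0 mul1r => /le_trans; apply.
  by rewrite normrM (ger0_norm u0) mulrC.
- apply: integrable01_continuous.
  exact: (continuous_dilation (@continuous_cos R)).
- move=> s u /andP[u0 u1].
  rewrite (_ : _ - _ = (sin (u * s) - sin (u * t) - (u * s - u * t) * cos (u * t)) / u).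
    have := taylor1_lipschitz (@is_derive_sin R) cos_lipschitz (u * t) (u * s).
    rewrite normrM normfV (gtr0_norm u0) ler_pdivrMr// => /le_trans; apply.
    rewrite !mul1r -mulrBr exprMn mulrC ler_wpM2l ?sqr_ge0//.
    by rewrite expr2 ler_piMr// ltW.
  by field; rewrite gt_eqF.
Qed.

Lemma mulr_integral01_sin (t : R) : t * integral01 (fun u => - sin (u * t)) = cos t - 1.
Proof.
rewrite -cos0; apply: (integral01_FTC t (@is_derive_cos R)) => u.
by apply: cvgN; exact: continuous_sin.
Qed.

Lemma mulr_integral01_cos (t : R) : t * integral01 (fun u => cos (u * t)) = sin t.
Proof.
rewrite (integral01_FTC t (@is_derive_sin R)) ?sin0 ?subr0//.
exact: continuous_cos.
Qed.

Definition dickman_re (t : R) : R := expR (log_modulus t) * cos (phase t).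
Definition dickman_im (t : R) : R := expR (log_modulus t) * sin (phase t).

(** The characteristic function [phi] satisfies [t phi' = (exp(it) - 1) phi], that
    is, the derivative of [t phi] is [exp(it) phi]; this is the real part. *)
Lemma is_derive_mulr_dickman_re (t : R) :
  is_derive t 1 (fun t => t * dickman_re t)
    (cos t * dickman_re t - sin t * dickman_im t).
Proof.
have dA := is_derive_log_modulus t; have dB := is_derive_phase t.
have tA := mulr_integral01_sin t; have tB := mulr_integral01_cos t.
move: (integral01 _) (integral01 _) dA dB tA tB => B' A' dA dB tA tB.
have dE : is_derive t 1 (fun t => expR (log_modulus t)) (expR (log_modulus t) * A').
  exact: (@is_derive1_comp R expR log_modulus t _ _ (is_derive_expR _) dA).
have dC : is_derive t 1 (fun t => cos (phase t)) (- sin (phase t) * B').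
  exact: (@is_derive1_comp R cos phase t _ _ (is_derive_cos _) dB).
have dEC := is_deriveM dE dC.
have dF := is_deriveM (is_derive_id t 1) dEC.
apply: is_derive_eq dF _.
rewrite -![_ *: _]/(_ * _) /dickman_re /dickman_im.
have -> : cos t = 1 + t * A' by rewrite tA addrC subrK.
by rewrite -tB mulrfctE; ring.
Qed.

Lemma is_derive_mulr_dickman_im (t : R) :
  is_derive t 1 (fun t => t * dickman_im t)
    (cos t * dickman_im t + sin t * dickman_re t).
Proof.
have dA := is_derive_log_modulus t; have dB := is_derive_phase t.
have tA := mulr_integral01_sin t; have tB := mulr_integral01_cos t.
move: (integral01 _) (integral01 _) dA dB tA tB => B' A' dA dB tA tB.
have dE : is_derive t 1 (fun t => expR (log_modulus t)) (expR (log_modulus t) * A').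
  exact: (@is_derive1_comp R expR log_modulus t _ _ (is_derive_expR _) dA).
have dS : is_derive t 1 (fun t => sin (phase t)) (cos (phase t) * B').
  exact: (@is_derive1_comp R sin phase t _ _ (is_derive_sin _) dB).
have dES := is_deriveM dE dS.
have dF := is_deriveM (is_derive_id t 1) dES.
apply: is_derive_eq dF _.
rewrite -![_ *: _]/(_ * _) /dickman_re /dickman_im.
have -> : cos t = 1 + t * A' by rewrite tA addrC subrK.
by rewrite -tB mulrfctE; ring.
Qed.

Lemma continuous_dickman_re_im : continuous dickman_re /\ continuous dickman_im.
Proof.
have cA : continuous log_modulus := is_derive_continuous is_derive_log_modulus.
have cB : continuous phase := is_derive_continuous is_derive_phase.
have cE : continuous (fun t => expR (log_modulus t)).
  by move=> t; apply: continuous_comp; [exact: cA|exact: continuous_expR].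
split=> t; apply: (@cvgM _ _ _ _ (fun t => expR (log_modulus t))); try exact: cE.
- by apply: continuous_comp; [exact: cB|exact: continuous_cos].
- by apply: continuous_comp; [exact: cB|exact: continuous_sin].
Qed.

(** At [t = 0] the integral identity carries no information, and the value has to
    be given separately. *)
Lemma integral01_of_mulr_derive (g G1 : R -> R) (t : R) :
  (forall x : R, is_derive x 1 (fun x => x * g x) (G1 x)) -> continuous G1 ->
  G1 0 = g 0 -> integral01 (fun u => G1 (u * t)) = g t.
Proof.
move=> gd cG1 G10; have [->|t0] := eqVneq t 0.
  rewrite -[RHS]integral01_cst; apply: eq_integral01 => u.
  by rewrite mulr0.
apply: (mulfI t0); rewrite (integral01_FTC t gd cG1).
by rewrite mul0r subr0.
Qed.

Section fixed_point.
Context d (T : measurableType d) (Q : probability T R) (Z : {RV Q >-> R}).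
Hypothesis Z_dickman : dickman Z.

(** Real and imaginary parts of the defining equation of the Dickman law. *)
Lemma dickman_char_fun (t : R) :
  mean Q (fun w => cos (t * Z w)) = dickman_re t /\
  mean Q (fun w => sin (t * Z w)) = dickman_im t.
Proof.
have := Z_dickman t; rewrite /char_fun /Cintegral /Cexp.
move=> /eqP; rewrite eq_complex => /andP[/eqP/= re /eqP/= im].
have eE (y : R) : expR (0 * y - 1 * 0) = 1 by rewrite mul0r mulr0 subr0 expR0.
have aE (y : R) : 0 * 0 + 1 * y = y by rewrite mul0r add0r mul1r.
have vE (x : R) : x / (x ^+ 2 + 0 ^+ 2) = x^-1.
  rewrite expr0n addr0 expr2; have [->|x0] := eqVneq x 0.
    by rewrite mul0r invr0.
  by rewrite invfM mulrA mulfV// mul1r.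
split.
- transitivity (\int[Q]_x (expR (0 * (t * Z x) - 1 * 0) * cos (0 * 0 + 1 * (t * Z x)))).
    by congr (Rintegral Q setT _); apply/funext => w; rewrite eE aE mul1r.
  rewrite re /dickman_re; congr (expR _ * cos _); apply: eq_Rintegral => x _.
    by rewrite eE aE vE mul0r oppr0 mulr0 subr0 mul1r (mulrC t).
  by rewrite eE aE vE mul0r oppr0 mulr0 add0r mul1r addr0 (mulrC t).
- transitivity (\int[Q]_x (expR (0 * (t * Z x) - 1 * 0) * sin (0 * 0 + 1 * (t * Z x)))).
    by congr (Rintegral Q setT _); apply/funext => w; rewrite eE aE mul1r.
  rewrite im /dickman_im; congr (expR _ * sin _); apply: eq_Rintegral => x _.
    by rewrite eE aE vE mul0r oppr0 mulr0 subr0 mul1r (mulrC t).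
  by rewrite eE aE vE mul0r oppr0 mulr0 add0r mul1r addr0 (mulrC t).
Qed.

Lemma continuous_measurable_cos_sin (t : R) :
  measurable_fun setT (fun x : R => cos (t * x)) /\
  measurable_fun setT (fun x : R => sin (t * x)).
Proof.
by split; [exact: (trig_poly_measurable_bounded (trig_cos t)).1|
           exact: (trig_poly_measurable_bounded (trig_sin t)).1].
Qed.

(** By the differential equation of [phi], the characteristic function of [Z] at
    [t] is the integral over [u] in [0, 1] of [exp(iut) phi(ut)], which is the
    mean of [exp(it u (Z + 1))]. So [Z] and [U (Z + 1)] have the same
    characteristic function. *)
Theorem dickman_fixed_point (L M : R) (h : R -> R) :
  (forall x y, `|h x - h y| <= L * `|x - y|) -> (forall x, `|h x| <= M) ->
  mean Q (fun w => h (Z w)) = mean Q (fun w => dickman_mean h (Z w)).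
Proof.
move=> hL hM.
have mZ : measurable_fun setT (Z : T -> R) by exact: measurable_funP.
(* U (Z + 1), realized on the product of the space of Z by the uniform law. *)
pose Y (z : T * R) : R := z.2 * (Z z.1 + 1).
have mY : measurable_fun setT Y.
  apply: measurable_funM; first exact: measurable_snd.
  apply: measurable_funD; last exact: measurable_cst.
  exact: (measurableT_comp mZ measurable_fst).
have intM (f : R -> R) (N : R) : measurable_fun setT f -> (forall x, `|f x| <= N) ->
    Q.-integrable setT (EFin \o (f \o Z)).
  move=> mf fN; apply: (@bounded_integrable_prob _ _ _ _ _ N).
    exact: (measurableT_comp mf mZ).
  by move=> w; exact: fN.
have [cre cim] := continuous_dickman_re_im.
have cint t : Q.-integrable setT (EFin \o ((fun x => cos (t * x)) \o Z)).
  by apply: (intM _ 1); [exact: (continuous_measurable_cos_sin t).1|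
                         move=> x; exact: cos_max].
have sint t : Q.-integrable setT (EFin \o ((fun x => sin (t * x)) \o Z)).
  by apply: (intM _ 1); [exact: (continuous_measurable_cos_sin t).2|
                         move=> x; exact: sin_max].
have cZ1 t : mean Q (fun w => cos (t * (Z w + 1))) =
    cos t * dickman_re t - sin t * dickman_im t.
  have [<- <-] := dickman_char_fun t.
  rewrite -(meanZ (cos t) (cint t)) -(meanZ (sin t) (sint t)) -meanB.
  - congr (mean Q); apply/funext => w; rewrite mulrDr mulr1 cosD /=.
    by rewrite (mulrC (cos (t * _))) (mulrC (sin (t * _))).
  - exact: (@integrableZl _ _ _ Q setT measurableT (cos t) _ (cint t)).
  - exact: (@integrableZl _ _ _ Q setT measurableT (sin t) _ (sint t)).
have sZ1 t : mean Q (fun w => sin (t * (Z w + 1))) =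
    cos t * dickman_im t + sin t * dickman_re t.
  have [<- <-] := dickman_char_fun t.
  rewrite -(meanZ (sin t) (cint t)) -(meanZ (cos t) (sint t)) -meanD.
  - congr (mean Q); apply/funext => w; rewrite mulrDr mulr1 sinD /=.
    by rewrite (mulrC (cos (t * _))) (mulrC (sin (t * _))).
  - exact: (@integrableZl _ _ _ Q setT measurableT (cos t) _ (sint t)).
  - exact: (@integrableZl _ _ _ Q setT measurableT (sin t) _ (cint t)).
have avg (f : R -> R) (N : R) : measurable_fun setT f -> (forall x, `|f x| <= N) ->
    mean (Q \x U)%E (fun z => f (Y z)) = mean Q (fun w => dickman_mean f (Z w)).
  move=> mf fN; rewrite (@mean_prod1 _ _ _ _ _ _ _ _ N)//; last first.
    exact: (measurableT_comp mf mY).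
  congr (mean Q); apply/funext => w; rewrite (@mean_uniform _ N)//.
  exact: (measurableT_comp (measurableT_comp mf mY) (pair1_measurable w)).
have avg2 (f K : R -> R) (N : R) : measurable_fun setT f -> (forall x, `|f x| <= N) ->
    continuous K -> (forall u, mean Q (fun w => f (u * (Z w + 1))) = K u) ->
    mean (Q \x U)%E (fun z => f (Y z)) = integral01 K.
  move=> mf fN cK fK; rewrite (@mean_prod2 _ _ _ _ _ _ _ _ N)//; last first.
    exact: (measurableT_comp mf mY).
  rewrite (_ : (fun u => _) = K); last by apply/funext => u; exact: fK.
  apply: (@mean_uniform _ N); first exact: continuous_measurable_fun.
  move=> u; rewrite -fK -[X in `|X|]subr0 -(mean_cst Q 0).
  apply: mean_dist => [| |w]; last by rewrite subr0.
  - apply: (@bounded_integrable_prob _ _ _ _ _ N) => //.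
    exact: (measurableT_comp (measurableT_comp mf mY) (pair2_measurable u)).
  - apply: (@bounded_integrable_prob _ _ _ _ _ 0) => // w.
    by rewrite normr0.
have mh : measurable_fun setT h.
  by apply: continuous_measurable_fun; exact: lipschitz_continuous hL.
rewrite -(avg h M mh hM).
apply: (@char_fun_unique _ _ _ _ _ Q (Q \x U)%E Z Y mZ mY _ _ L M h hL hM) => t.
- rewrite (dickman_char_fun t).1.
  have cK : continuous (fun t => cos t * dickman_re t - sin t * dickman_im t).
    move=> x; apply: cvgB; apply: cvgM; try exact: cre; try exact: cim.
    * exact: continuous_cos.
    * exact: continuous_sin.
  rewrite -(integral01_of_mulr_derive t is_derive_mulr_dickman_re cK); last first.
    by rewrite cos0 sin0 mul1r mul0r subr0.
  apply/esym/(avg2 (fun x => cos (t * x)) _ 1).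
  + exact: (continuous_measurable_cos_sin t).1.
  + by move=> x; exact: cos_max.
  + exact: (@continuous_dilation _ _ t cK).
  + by move=> u; rewrite -cZ1; congr (mean Q); apply/funext => w; rewrite mulrCA mulrA.
- rewrite (dickman_char_fun t).2.
  have cK : continuous (fun t => cos t * dickman_im t + sin t * dickman_re t).
    move=> x; apply: cvgD; apply: cvgM; try exact: cre; try exact: cim.
    * exact: continuous_cos.
    * exact: continuous_sin.
  rewrite -(integral01_of_mulr_derive t is_derive_mulr_dickman_im cK); last first.
    by rewrite cos0 sin0 mul1r mul0r addr0.
  apply/esym/(avg2 (fun x => sin (t * x)) _ 1).
  + exact: (continuous_measurable_cos_sin t).2.
  + by move=> x; exact: sin_max.
  + exact: (@continuous_dilation _ _ t cK).
  + by move=> u; rewrite -sZ1; congr (mean Q); apply/funext => w; rewrite mulrCA mulrA.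
Qed.

End fixed_point.

End dickman_law.

(** * Mertens' first theorem *)

Section prime_sums.
Context {R : realType}.
Local Notation lnn n := (ln (n%:R : R)).

Lemma lnn_ge0 (n : nat) : 0 <= lnn n.
Proof.
by case: n => [|n]; [rewrite ln0|rewrite ln_ge0// ler1n].
Qed.

Lemma lnnM (m n : nat) : (0 < m)%N -> (0 < n)%N -> lnn (m * n) = lnn m + lnn n.
Proof. by move=> m0 n0; rewrite natrM lnM// posrE ltr0n. Qed.

Lemma lnnX (m k : nat) : (0 < m)%N -> lnn (m ^ k) = k%:R * lnn m.
Proof. by move=> m0; rewrite natrX lnXn ?ltr0n// mulr_natl. Qed.

Lemma ler_lnn (m n : nat) : (0 < m)%N -> (m <= n)%N -> lnn m <= lnn n.
Proof.
move=> m0 mn; rewrite ler_ln ?posrE ?ltr0n ?ler_nat//.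
exact: leq_trans mn.
Qed.

Lemma lnn_prime_gt0 (p : nat) : prime p -> 0 < lnn p.
Proof. by move=> pp; rewrite ln_gt0// ltr1n prime_gt1. Qed.

(** The hypothesis lets a factor vanish when its exponent does: the index 0 occurs
    in the factorizations below. *)
Lemma lnn_prod_pow (r : seq nat) (P : pred nat) (F e : nat -> nat) :
  (forall i, i \in r -> e i != 0%N -> (0 < F i)%N) ->
  lnn (\prod_(i <- r | P i) F i ^ e i)%N = \sum_(i <- r | P i) (e i)%:R * lnn (F i).
Proof.
move=> F0.
suff [H _] : lnn (\prod_(i <- r | P i) F i ^ e i)%N =
    \sum_(i <- r | P i) (e i)%:R * lnn (F i) /\
    (0 < \prod_(i <- r | P i) F i ^ e i)%N by [].
elim: r F0 => [|i r IH] F0; first by rewrite !big_nil ln1.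
have [IH1 IH2] := IH (fun j jr => F0 j (mem_behead (s := i :: r) jr)).
rewrite !big_cons; case: (P i) => //.
have pow0 : (0 < F i ^ e i)%N.
  have [->|ei] := eqVneq (e i) 0%N; first by rewrite expn0.
  by rewrite expn_gt0 F0// inE eqxx.
rewrite muln_gt0 pow0 IH2; split=> //.
rewrite lnnM// IH1; congr (_ + _).
have [->|ei] := eqVneq (e i) 0%N; first by rewrite expn0 ln1 mul0r.
by rewrite lnnX// F0// inE eqxx.
Qed.

Lemma lnn_factorization (n K : nat) : (0 < n)%N -> (n <= K)%N ->
  lnn n = \sum_(0 <= p < K.+1 | prime p) (logn p n)%:R * lnn p.
Proof.
move=> n0 nK; rewrite -{1}(partnT n0) (widen_partn _ nK) lnn_prod_pow; last first.
  by move=> [|p _ _]//; rewrite lognE.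
rewrite [LHS]big_mkcond [RHS]big_mkcond/=; apply: eq_bigr => p _.
by case: ifPn => // /negbTE np; rewrite lognE np mul0r.
Qed.

Lemma le_lnn_factorization (n K : nat) : (0 < n)%N ->
  \sum_(0 <= p < K.+1 | prime p) (logn p n)%:R * lnn p <= lnn n.
Proof.
move=> n0; rewrite (@lnn_factorization n (maxn n K))// ?leq_maxl//.
rewrite [leRHS](@big_cat_nat _ _ _ K.+1)//=; last by rewrite ltnS leq_maxr.
by rewrite lerDl sumr_ge0// => p _; rewrite mulr_ge0 ?lnn_ge0.
Qed.

Lemma logn_fact_gt (p m : nat) : prime p -> (m < p)%N -> logn p m`! = 0%N.
Proof.
move=> pp mp; rewrite logn_fact// big_nat_cond big1// => k /andP[/andP[k0 _] _].
rewrite divn_small// (leq_trans mp)// -{1}(expn1 p) leq_exp2l//.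
exact: prime_gt1.
Qed.

Lemma lnn_fact_factorization (n : nat) :
  lnn n`! = \sum_(0 <= p < n.+1 | prime p) (logn p n`!)%:R * lnn p.
Proof.
rewrite (@lnn_factorization _ (maxn n n`!)) ?fact_gt0 ?leq_maxr//.
rewrite (@big_cat_nat _ _ _ n.+1)//=; last by rewrite ltnS leq_maxl.
rewrite [X in _ + X]big_nat_cond [X in _ + X]big1 ?addr0// => p.
by move=> /andP[/andP[np _] pp]; rewrite logn_fact_gt// mul0r.
Qed.

Lemma central_binomial_le (m : nat) : ('C(m.*2, m) <= 4 ^ m)%N.
Proof.
have -> : (4 ^ m = (1 + 1) ^ m.*2)%N by rewrite -mul2n expnM.
have mm : (m < m.*2.+1)%N by rewrite ltnS -addnn leq_addr.
rewrite expnDn (bigD1 (Ordinal mm))//= !exp1n !muln1 leq_addr//.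
Qed.

Lemma prime_dvd_central_binomial (p m : nat) : prime p ->
  (m < p <= m.*2)%N -> (0 < logn p 'C(m.*2, m))%N.
Proof.
move=> pp /andP[mp pm].
have mm : (m <= m.*2)%N by rewrite -addnn leq_addr.
have := bin_fact mm; rewrite -{2}addnn addnK => /(congr1 (logn p)).
rewrite !lognM ?muln_gt0 ?fact_gt0 ?bin_gt0// (logn_fact_gt pp mp) !addn0 => ->.
rewrite logn_gt0 mem_primes pp fact_gt0 dvdn_fact//.
by rewrite prime_gt0.
Qed.

(** Every prime between [m] and [2 m] divides the central binomial coefficient,
    which is at most [4 ^ m]. *)
Lemma chebyshev_step (m : nat) :
  \sum_(m.+1 <= p < m.*2.+1 | prime p) lnn p <= 2 * m%:R.
Proof.
have C0 : (0 < 'C(m.*2, m))%N by rewrite bin_gt0 -addnn leq_addr.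
apply: (@le_trans _ _ (lnn 'C(m.*2, m))).
  apply: le_trans (le_lnn_factorization m.*2 C0).
  rewrite [leRHS](@big_cat_nat _ _ _ m.+1)//=; last by rewrite ltnS -addnn leq_addr.
  rewrite ler_wpDl//; first by rewrite sumr_ge0// => p _; rewrite mulr_ge0 ?lnn_ge0.
  rewrite big_nat_cond [leRHS]big_nat_cond; apply: ler_sum => p /andP[pm pp].
  rewrite ler_peMl ?lnn_ge0// ler1n; apply: prime_dvd_central_binomial => //.
apply: le_trans (ler_lnn C0 (central_binomial_le m)) _.
rewrite lnnX// mulrC ler_wpM2r//.
have -> : 4%:R = 2%:R ^+ 2 :> R by rewrite -natrX.
rewrite lnXn//; have : lnn 2 <= 1.
  by have := @le_ln1Dx R 1 _; rewrite -natr1; apply; lra.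
lra.
Qed.

(** Dyadic induction. When [n] is odd, the last term is bounded by [ln n <= n],
    which the slack between 4 and the constant 2 of the dyadic step absorbs. *)
Lemma chebyshev_theta_le (n : nat) :
  \sum_(0 <= p < n.+1 | prime p) lnn p <= 4 * n%:R.
Proof.
elim/ltn_ind: n => n IH.
have even_case m : (0 < m)%N -> (m.*2 <= n)%N ->
    \sum_(0 <= p < m.*2.+1 | prime p) lnn p <= 6 * m%:R.
  move=> m0 mn.
  rewrite (@big_cat_nat _ _ _ m.+1)//=; last by rewrite ltnS -addnn leq_addr.
  have -> : 6 * m%:R = 4 * m%:R + 2 * m%:R :> R by ring.
  rewrite lerD ?chebyshev_step//; apply: IH.
  by rewrite (leq_trans _ mn)// -addnn -[X in (X < _)%N]addn0 ltn_add2l.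
have [->|n0] := posnP n.
  by rewrite big_mkcond big_nat1/= mulr0.
have [on|en] := boolP (odd n); last first.
  have nE : n = n./2.*2 by rewrite -[LHS]odd_double_half (negbTE en).
  have h0 : (0 < n./2)%N by move: n0; rewrite {1}nE double_gt0.
  rewrite {1}nE; apply: (le_trans (even_case _ h0 _)); first by rewrite -nE.
  rewrite [in leRHS]nE -muln2 natrM; have : 0 <= (n./2)%:R :> R by [].
  lra.
have nE : n = n./2.*2.+1 by rewrite -[LHS]odd_double_half on.
set m := n./2 in nE *.
rewrite nE big_mkcond big_nat_recr//= -big_mkcond/=.
have last_le : (if prime m.*2.+1 then lnn m.*2.+1 else 0) <= (m.*2)%:R.
  case: ifP => // _; rewrite -natr1 addrC le_ln1Dx//.
  by rewrite (lt_le_trans (ltrN10 R)).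
have [m0|m0] := posnP m.
  move: last_le; rewrite m0 double0 /= big_mkcond big_nat1/= add0r => /le_trans; apply.
  by lra.
have ev := even_case _ m0 _.
rewrite (le_trans (lerD (ev _) last_le))//.
  by rewrite nE.
rewrite -natr1 -muln2 natrM; have : 0 <= m%:R :> R by [].
lra.
Qed.

Lemma lnn_fact_le (n : nat) : lnn n`! <= n%:R * lnn n.
Proof.
case: n => [|n]; first by rewrite fact0 ln1 mul0r.
rewrite -lnnX// ler_lnn ?fact_gt0//.
elim: n.+1 => [//|k IH]; rewrite factS expnS leq_mul//.
apply: (leq_trans IH); case: k {IH} => // k.
by rewrite leq_exp2r.
Qed.

Lemma lnn_fact_ge (n : nat) : n%:R * lnn n - n%:R <= lnn n`!.
Proof.
elim: n => [|n IH]; first by rewrite mul0r subr0 fact0 ln1.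
case: n IH => [|n] IH; first by rewrite factS fact0 muln1 ln1 mulr0 sub0r oppr_le0.
set N : R := n.+1%:R.
have N0 : 0 < N by rewrite /N ltr0n.
rewrite factS lnnM ?fact_gt0//.
have H : N * (lnn n.+2 - lnn n.+1) <= 1.
  rewrite -ln_div ?posrE ?ltr0n//.
  have -> : n.+2%:R / n.+1%:R = 1 + N^-1.
    by rewrite -[n.+2]addn1 natrD mulrDl mulfV ?mul1r// gt_eqF.
  rewrite -ler_pdivlMl// mulr1 le_ln1Dx//.
  by rewrite (lt_trans (ltrN10 R))// invr_gt0.
have E : n.+2%:R = N + 1 by rewrite /N natr1.
rewrite E in H *; rewrite -/N in IH *.
move: IH H; rewrite mulrBr => IH H.
by rewrite mulrDl mul1r; lra.
Qed.

(** The first term of Legendre's formula. *)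
Lemma logn_fact_ge (p n : nat) : prime p ->
  n%:R / p%:R - 1 <= (logn p n`!)%:R :> R.
Proof.
move=> pp; have p0 : 0 < p%:R :> R by rewrite ltr0n prime_gt0.
rewrite lerBlDr; case: n => [|n]; first by rewrite mul0r ler_wpDl.
rewrite logn_fact// big_nat_recl// expn1 natrD.
rewrite ler_pdivrMr//.
have : n.+1%:R <= (n.+1 %/ p)%:R * p%:R + p%:R :> R.
  by rewrite -natrM -natrD ler_nat {1}(divn_eq n.+1 p) leq_add2l ltnW// ltn_mod prime_gt0.
move=> /le_trans; apply; rewrite !mulrDl mul1r addrAC lerDl.
by rewrite mulr_ge0// ltW.
Qed.

Lemma geometric_sum_le (p n : nat) : (1 < p)%N ->
  \sum_(1 <= k < n.+1) (p%:R ^+ k)^-1 <= (p%:R - 1)^-1 :> R.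
Proof.
move=> p1; have p0 : 0 < p%:R - 1 :> R by rewrite subr_gt0 ltr1n.
have pp : 0 < p%:R :> R by rewrite ltr0n (ltn_trans _ p1).
suff -> : \sum_(1 <= k < n.+1) (p%:R ^+ k)^-1 = (p%:R - 1)^-1 * (1 - (p%:R ^+ n)^-1) :> R.
  by rewrite ler_piMr ?invr_ge0 ?(ltW p0)// lerBlDl lerDr invr_ge0 exprn_ge0// ltW.
elim: n => [|n IH]; first by rewrite big_geq// expr0 invr1 subrr mulr0.
rewrite big_nat_recr//= IH exprS.
by field; rewrite !gt_eqF// exprn_gt0.
Qed.

(** Legendre's formula, without the integer parts, is a geometric series. *)
Lemma logn_fact_le (p n : nat) : prime p ->
  (logn p n`!)%:R <= n%:R / (p%:R - 1) :> R.
Proof.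
move=> pp; rewrite logn_fact// natr_sum.
apply: (@le_trans _ _ (\sum_(1 <= k < n.+1) n%:R * (p%:R ^+ k)^-1)).
  apply: ler_sum => k _; rewrite ler_pdivlMr ?exprn_gt0 ?ltr0n ?prime_gt0//.
  by rewrite -natrX -natrM ler_nat leq_divM.
by rewrite -mulr_sumr ler_wpM2l// geometric_sum_le// prime_gt1.
Qed.

(** With [g k = (ln (k + 1) + 1) / k], the difference [g (k - 1) - g k] is at least
    [ln k / (k (k - 1))], so that the sum over all integers telescopes. *)
Lemma sum_ln_div_sqr_le (N : nat) :
  \sum_(0 <= p < N.+1 | prime p) lnn p / (p%:R ^+ 2 - 1) <= 2.
Proof.
pose g (k : nat) : R := (lnn k.+1 + 1) / k%:R.
have g_ge0 k : 0 <= g k by rewrite /g divr_ge0// addr_ge0// lnn_ge0.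
suff H : \sum_(0 <= p < N.+2 | prime p) lnn p / (p%:R ^+ 2 - 1) <= 2 - g N.+1.
  apply: (@le_trans _ _ (2 - g N.+1)); last by rewrite lerBlDr lerDl.
  apply: le_trans H; rewrite [leRHS]big_mkcond [leRHS]big_nat_recr//= -big_mkcond/=.
  rewrite lerDl; case: ifP => // pp.
  by rewrite divr_ge0 ?lnn_ge0// subr_ge0 expr_ge1// ler1n.
elim: N => [|N IH].
  rewrite big_mkcond 2?big_nat_recr//= big_geq// !add0r.
  rewrite /g divr1; have : lnn 2 <= 1.
    by have := @le_ln1Dx R 1 _; rewrite -natr1; apply; lra.
  lra.
rewrite big_mkcond big_nat_recr//= -big_mkcond/=.
rewrite (le_trans (lerD IH (lexx _)))// -lerBrDl.
rewrite (_ : _ - _ - _ = g N.+1 - g N.+2); last by ring.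
set k := N.+2; set x : R := k%:R.
have x1 : 1 <= N.+1%:R :> R by rewrite ler1n.
have xE : x = N.+1%:R + 1 by rewrite /x /k -natr1.
have H : (x - 1) * (lnn k.+1 - lnn k) <= 1.
  rewrite -ln_div ?posrE ?ltr0n//.
  have -> : k.+1%:R / k%:R = 1 + x^-1.
    by rewrite -(addn1 k) natrD mulrDl mulfV ?mul1r// gt_eqF.
  have : ln (1 + x^-1) <= x^-1.
    by rewrite le_ln1Dx// (lt_trans (ltrN10 R))// invr_gt0; lra.
  have x0 : 0 < x by lra.
  move=> /(ler_wpM2l (_ : 0 <= x - 1)) -/(_ _)/le_trans; apply; first by lra.
  by rewrite ler_pdivrMr// mul1r; lra.
apply: (@le_trans _ _ (lnn k / (x * (x - 1)))).
  case: ifP => _; last first.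
    by rewrite divr_ge0 ?lnn_ge0// mulr_ge0; lra.
  rewrite ler_wpM2l ?lnn_ge0// lef_pV2 ?posrE; last 2 first.
    by rewrite subr_gt0 exprn_egt1//; lra.
    by rewrite mulr_gt0//; lra.
  by rewrite mulrBr mulr1 -expr2; lra.
rewrite /g -/k -/x.
have -> : N.+1%:R = x - 1 by rewrite xE addrK.
rewrite -subr_ge0.
have -> : (lnn k + 1) / (x - 1) - (lnn k.+1 + 1) / x - lnn k / (x * (x - 1)) =
    (1 - (x - 1) * (lnn k.+1 - lnn k)) / (x * (x - 1)).
  by field; apply/andP; split; rewrite gt_eqF; lra.
by rewrite divr_ge0 ?subr_ge0// mulr_ge0; lra.
Qed.

(** Legendre's formula sandwiches [ln N!] between [N] times the sum of [ln p / p],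
    less [theta N], and [N] times the sum of [ln p / (p - 1)]. The left side is
    [N ln N] up to [N] by Stirling, [theta N] is at most [4 N] by Chebyshev, and
    the sums with [p - 1], [p] and [p + 1] differ by a convergent series. *)
Theorem mertens_first (N : nat) : (0 < N)%N ->
  `|\sum_(0 <= p < N.+1 | prime p) lnn p / (1 + p%:R) - lnn N| <= 5.
Proof.
move=> N0; have N0' : 0 < N%:R :> R by rewrite ltr0n.
pose S (w : nat -> R) : R := \sum_(0 <= p < N.+1 | prime p) lnn p * w p.
have S_le w w' : (forall p, prime p -> w p <= w' p) -> S w <= S w'.
  by move=> ww; apply: ler_sum => p pp; rewrite ler_wpM2l ?lnn_ge0// ww.
have SE : \sum_(0 <= p < N.+1 | prime p) lnn p / (1 + p%:R) =
   S (fun p => (1 + p%:R)^-1) by [].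
have upper : S (fun p => p%:R^-1) <= lnn N + 4.
  rewrite -(ler_pM2l N0') mulrDr (mulrC _ 4).
  apply: (@le_trans _ _ (lnn N`! + 4 * N%:R)); last by rewrite lerD2r lnn_fact_le.
  rewrite -lerBlDr (le_trans (lerB (lexx _) (chebyshev_theta_le N)))//.
  rewrite lnn_fact_factorization /S mulr_sumr -sumrB; apply: ler_sum => p pp.
  rewrite mulrCA mulrC -[X in _ - X]mul1r -mulrBl ler_wpM2r ?lnn_ge0//.
  exact: logn_fact_ge.
have lower : lnn N - 1 <= S (fun p => (p%:R - 1)^-1).
  rewrite -(ler_pM2l N0') mulrBr mulr1 (le_trans (lnn_fact_ge N))//.
  rewrite lnn_fact_factorization /S mulr_sumr; apply: ler_sum => p pp.
  by rewrite mulrCA mulrC ler_wpM2l ?lnn_ge0// logn_fact_le.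
have gap : S (fun p => (p%:R - 1)^-1) - S (fun p => (1 + p%:R)^-1) <= 4.
  have := sum_ln_div_sqr_le N; rewrite -(ler_pM2l (_ : 0 < 2 :> R))//.
  rewrite -natrM; apply: le_trans.
  rewrite /S -sumrB mulr_sumr; apply: ler_sum => p pp.
  have p1 : 1 < p%:R :> R by rewrite ltr1n prime_gt1.
  rewrite le_eqVlt; apply/orP; left; apply/eqP; field.
  have p2 : 1 < p%:R ^+ 2 :> R by rewrite exprn_egt1.
  by apply/and3P; split; rewrite gt_eqF//; lra.
have up2 : S (fun p => (1 + p%:R)^-1) <= S (fun p => p%:R^-1).
  apply: S_le => p pp; rewrite lef_pV2 ?posrE ?ltr0n ?prime_gt0//.
  - by rewrite lerDr.
rewrite SE ler_norml; apply/andP; split; lra.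
Qed.

End prime_sums.

(** * Comparison of a weighted Bernoulli sum with the averaging operator *)

Section stein_comparison.
Context {R : realType}.

(** The weights [w i], placed at the points [a i], nearly form the Lebesgue measure:
    their cumulative sums differ from the points by at most [delta]. Summation by
    parts compares the weighted sum of [f] to its Riemann sum along the [a i],
    and the Riemann sum is compared to the increment of the primitive [F] by
    Taylor's formula. The boundary term of the summation by parts stays on the
    left, which lets a single induction carry both comparisons. *)
Lemma abel_riemann (n : nat) (a w : nat -> R) (F f : R -> R) (L delta : R) :
  a 0%N = 0 -> (forall i, a i <= a i.+1) ->
  (forall i, (i <= n)%N -> w i <= delta) ->
  (forall j, (j <= n)%N -> `|\sum_(1 <= i < j.+1) w i - a j| <= delta) ->
  (forall x : R, is_derive x 1 F (f x)) ->
  (forall x y, `|f x - f y| <= L * `|x - y|) ->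
  `|\sum_(1 <= i < n.+1) w i * f (a i) - (F (a n) - F 0)
    - (\sum_(1 <= i < n.+1) w i - a n) * f (a n)| <= 4 * delta * L * a n.
Proof.
move=> a0 a_incr wd Gd Fd fL.
have L0 : 0 <= L by have := fL 1 0; rewrite subr0 normr1 mulr1; apply: le_trans.
elim: n wd Gd => [|n IH] wd Gd.
  by rewrite !big_geq// a0 !subrr mul0r !subr0 normr0 mulr0.
have {}IH := IH (fun i ni => wd i (leqW ni)) (fun j nj => Gd j (leqW nj)).
have Dn := Gd n (leqnSn n); have Dn1 := Gd n.+1 (leqnn _).
have wn := wd n.+1 (leqnn _).
rewrite big_nat_recr//= [X in _ - (X - _) * _]big_nat_recr//=.
rewrite [\sum_(1 <= i < n.+2) _]big_nat_recr//= in Dn1.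
move: IH Dn Dn1.
set T := \sum_(1 <= i < n.+1) w i * f (a i); set G := \sum_(1 <= i < n.+1) w i.
move=> IH Dn Dn1.
have gap0 : 0 <= a n.+1 - a n by rewrite subr_ge0.
(* The points are no further apart than the weights and the discrepancy allow:
   no information on prime gaps enters. *)
have gap : a n.+1 - a n <= 3 * delta.
  by move: Dn Dn1; rewrite !ler_norml => /andP[? ?] /andP[? ?]; lra.
have taylor := taylor1_lipschitz Fd fL (a n.+1) (a n).
rewrite (_ : _ - _ - _ = (T - (F (a n) - F 0) - (G - a n) * f (a n)) +
  ((F (a n) - F (a n.+1) - (a n - a n.+1) * f (a n.+1)) +
   (G - a n) * (f (a n) - f (a n.+1)))); last by ring.
have -> : 4 * delta * L * a n.+1 =
    4 * delta * L * a n + (L * (3 * delta * (a n.+1 - a n)) +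
                           delta * (L * (a n.+1 - a n))) by ring.
rewrite (le_trans (ler_normD _ _))// lerD// (le_trans (ler_normD _ _))// lerD//.
  rewrite (le_trans taylor)// ler_wpM2l//.
  by rewrite -sqrrN opprB expr2 ler_wpM2r.
rewrite normrM ler_pM// (le_trans (fL _ _))// distrC ger0_norm//.
Qed.

(** By [dilation_mean_stein], the difference of the means is that of [S * f S] and of
    the increment of the primitive of [f] over [[S, S + 1]]. The first is close
    to the mean of the sum of [q i * a i * f (S + a i)], which is close to the
    second for every value of [S]. *)
Lemma dickman_mean_stein_bound (n : nat) (a q : nat -> R) (delta M L : R) h h1 :
  smooth_test M L h h1 ->
  a 0%N = 0 -> a n = 1 -> (forall i, a i <= a i.+1) ->
  (forall i, is_prob (q i)) ->
  (forall i, (i <= n)%N -> q i * a i <= delta) ->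
  (forall j, (j <= n)%N -> `|\sum_(1 <= i < j.+1) q i * a i - a j| <= delta) ->
  forall l : seq (R * R), l = [seq (q i, a i) | i <- index_iota 1 n.+1] ->
  `|bernoulli_mean l h - bernoulli_mean l (dickman_mean h)| <=
  L / 2 * (\sum_(1 <= i < n.+1) (q i * a i) ^+ 2 + 5 * delta).
Proof.
move=> st a0 an a_incr qP wd Gd l lE.
have ql : all (fun qa : R * R => is_prob qa.1) l.
  by rewrite lE; apply/allP => x /mapP[i _ ->]; exact: qP.
pose H := dilation_mean h; pose f := dilation_mean' h1.
have [_ Hd fB fL] := smooth_test_dilation_mean st.
have hE : h = (fun x => H x + x * f x).
  by apply/funext => x; exact: (dilation_mean_stein x st).
have sum_l (g : R * R -> R) :
    \sum_(qa <- l) g qa = \sum_(1 <= i < n.+1) g (q i, a i) by rewrite lE big_map.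
pose W := \sum_(qa <- l) qa.1 * qa.2 * bernoulli_mean l (fun x => f (x + qa.2)).
have stein : `|bernoulli_mean l (fun x => x * f x) - W| <=
    L / 2 * \sum_(1 <= i < n.+1) (q i * a i) ^+ 2.
  by have := bernoulli_mean_stein ql fL; rewrite (sum_l (fun qa => (qa.1 * qa.2) ^+ 2)).
have WE : W = bernoulli_mean l
    (fun x => \sum_(qa <- l) qa.1 * qa.2 * f (x + qa.2)).
  rewrite (@bernoulli_mean_sum R _ l l (fun qa x => qa.1 * qa.2 * f (x + qa.2))).
  by apply: eq_bigr => qa _; rewrite bernoulli_meanZ.
have riemann : `|W - bernoulli_mean l (fun x => H (x + 1) - H x)| <= L / 2 * (5 * delta).
  rewrite WE -bernoulli_meanB; apply: bernoulli_mean_bound => // y.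
  rewrite sum_l/=.
  have Hyd (x : R) : is_derive x 1 (fun x => H (y + x)) (f (y + x)).
    have H1 : is_derive x 1 (fun x : R => y + x) 1.
      by rewrite -[X in is_derive _ _ _ X]add0r; exact: is_deriveD.
    rewrite -[f (y + x)]mulr1.
    exact: (@is_derive1_comp R H (fun x => y + x) x _ _ (Hd (y + x)) H1).
  have fyL u v : `|f (y + u) - f (y + v)| <= L / 2 * `|u - v|.
    by apply: (le_trans (fL _ _)); rewrite opprD addrACA subrr add0r.
  have := @abel_riemann n a (fun i => q i * a i) (fun x => H (y + x))
    (fun x => f (y + x)) (L / 2) delta a0 a_incr wd Gd Hyd fyL.
  rewrite an addr0 mulr1; set G := \sum_(1 <= i < n.+1) q i * a i - 1.
  have Gn : `|G| <= delta by have := Gd n (leqnn n); rewrite an.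
  move=> ab.
  rewrite -[X in `|X|](subrK (G * f (y + 1))) (le_trans (ler_normD _ _))//.
  rewrite (_ : L / 2 * (5 * delta) = 4 * delta * (L / 2) + delta * (L / 2)); last by ring.
  by rewrite lerD// normrM ler_pM.
rewrite {1}hE bernoulli_meanD.
have -> : bernoulli_mean l (dickman_mean h) =
    bernoulli_mean l H + bernoulli_mean l (fun x => H (x + 1) - H x).
  by rewrite -bernoulli_meanD; congr bernoulli_mean; apply/funext => x; rewrite addrC subrK.
rewrite opprD addrACA subrr add0r mulrDr.
by rewrite (le_trans (ler_distD W _ _))// lerD.
Qed.

End stein_comparison.

(** * Independent Bernoulli variables *)

Section bernoulli_variables.
Context d (T : measurableType d) (R : realType) (P : probability T R).
Variables (X : nat -> {RV P >-> R}) (q c : nat -> R).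
Hypothesis X_indep : mutually_independent [set j | (0 < j)%N] X.
Hypothesis X_law0 : forall j, (0 < j)%N -> P (X j @^-1` [set 0]) = (1 - q j)%:E.
Hypothesis X_law1 : forall j, (0 < j)%N -> P (X j @^-1` [set 1]) = (q j)%:E.

Definition cylinder (J : {fset nat}) (B : nat -> set R) : set T :=
  \bigcap_(j in [set` J]) (X j @^-1` B j).

Definition set_at (B : nat -> set R) (i : nat) (C : set R) (j : nat) : set R :=
  if j == i then C else B j.

Lemma measurable_preimage_var (j : nat) (C : set R) :
  measurable C -> measurable (X j @^-1` C).
Proof. by move=> mC; rewrite -[X in measurable X]setTI; exact: measurable_funP. Qed.

Lemma measurable_cylinder J B : (forall j, measurable (B j)) ->
  measurable (cylinder J B).
Proof.
move=> mB; apply: bigcap_measurableType => j _; exact: measurable_preimage_var.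
Qed.

Lemma cylinderU J B (i : nat) (C : set R) : i \notin J ->
  cylinder (i |` J)%fset (set_at B i C) = cylinder J B `&` X i @^-1` C.
Proof.
move=> iJ; apply/seteqP; split=> [w cw|w [cw Ciw] j].
  split=> [j Jj|]; last first.
    have := cw i; rewrite /set_at eqxx; apply => /=.
    by rewrite !inE eqxx.
  have := cw j; rewrite /set_at; case: eqP => [ji|_].
    by move: iJ; rewrite -ji -/(is_true _) => /negP; case; exact: Jj.
  by apply; rewrite /= !inE; apply/orP; right; exact: Jj.
rewrite /= !inE /set_at => /orP[/eqP ->|Jj]; first by rewrite eqxx.
case: eqP => [ji|_]; first by move: iJ; rewrite -ji Jj.
exact: cw.
Qed.

Lemma cylinder_indep J B (i : nat) (C : set R) :
  [set` J] `<=` [set j | (0 < j)%N] -> (0 < i)%N -> i \notin J ->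
  (forall j, measurable (B j)) -> measurable C ->
  P (cylinder J B `&` X i @^-1` C) = (P (cylinder J B) * P (X i @^-1` C))%E.
Proof.
move=> J0 i0 iJ mB mC; rewrite -cylinderU// /cylinder.
rewrite (X_indep (J := (i |` J)%fset)); last 2 first.
- by move=> j; rewrite /= !inE => /orP[/eqP ->//|]; exact: J0.
- by move=> j _; rewrite /set_at; case: ifP.
rewrite (X_indep (J := J))//.
rewrite big_fsetU1//= muleC; congr (_ * _)%E; last by rewrite /set_at eqxx.
apply: eq_big_seq => j Jj; rewrite /set_at; case: eqP => // ji.
by move: iJ; rewrite -ji Jj.
Qed.

Lemma mean_indic_cst A (r : R) : measurable A ->
  mean P (fun w => \1_A w * r) = fine (P A) * r.
Proof.
move=> mA; rewrite /mean /Rintegral.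
under eq_integral do rewrite mulrC EFinM.
rewrite integralZl//; last exact: integrable_indic.
rewrite integral_indic// setIT.
have Afin := fin_num_measure P A mA.
by rewrite fineM//= mulrC.
Qed.

Lemma integrable_indic_mul (A : set T) (f : T -> R) (M : R) : measurable A ->
  measurable_fun setT f -> (forall w, `|f w| <= M) ->
  P.-integrable setT (EFin \o (fun w => \1_A w * f w)).
Proof.
move=> mA mf fM; apply: (@bounded_integrable_prob _ _ _ _ _ M).
  by apply: measurable_funM => //; exact: measurable_indic.
move=> w; rewrite indicE; case: (_ \in _); rewrite ?mul1r// mul0r normr0.
exact: le_trans (fM w).
Qed.

Lemma var_ae01 (i : nat) : (0 < i)%N -> {ae P, forall w, X i w = 0 \/ X i w = 1}.
Proof.
move=> i0; exists (~` (X i @^-1` [set 0] `|` X i @^-1` [set 1])); split.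
- by apply: measurableC; apply: measurableU; exact: measurable_preimage_var.
- have m0 := measurable_preimage_var i (measurable_set1 (0 : R)).
  have m1 := measurable_preimage_var i (measurable_set1 (1 : R)).
  rewrite probability_setC; last exact: measurableU.
  rewrite measureU//; last first.
    apply/seteqP; split=> // w [/= -> /eqP].
    by rewrite eq_sym oner_eq0.
  rewrite [X in (_ - (X + _))%E](X_law0 i0) [X in (_ - (_ + X))%E](X_law1 i0).
  by rewrite -EFinD subrK subrr.
- by move=> w /= nw [w0|w1]; apply: nw; [left|right].
Qed.

Lemma measurable_var_sum (s : seq nat) :
  measurable_fun setT (fun w => \sum_(i <- s) X i w * c i).
Proof.
apply: measurable_sum => i; apply: measurable_funM => //.
Qed.

(** The variables are removed one by one: on the event that the first one takes a
    given value, it is replaced by this value and the event is added to the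
    cylinder. The induction therefore runs over all cylinders at once. *)
Lemma mean_cylinder_sum (s : seq nat) J B (h : R -> R) (M : R) :
  uniq s -> (forall i, i \in s -> (0 < i)%N /\ i \notin J) ->
  [set` J] `<=` [set j | (0 < j)%N] -> (forall j, measurable (B j)) ->
  measurable_fun setT h -> (forall x, `|h x| <= M) ->
  mean P (fun w => \1_(cylinder J B) w * h (\sum_(i <- s) X i w * c i)) =
  fine (P (cylinder J B)) * bernoulli_mean [seq (q i, c i) | i <- s] h.
Proof.
elim: s J B h => [|i s IH] J B h us sJ J0 mB mh hM.
  under eq_fun do rewrite big_nil.
  by rewrite mean_indic_cst//; exact: measurable_cylinder.
move: us => /= /andP[is_ us].
have [i0 iJ] : (0 < i)%N /\ i \notin J by apply: sJ; rewrite inE eqxx.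
have J1 : [set` (i |` J)%fset] `<=` [set j | (0 < j)%N].
  by move=> j; rewrite /= !inE => /orP[/eqP ->//|]; exact: J0.
have sJ1 j : j \in s -> (0 < j)%N /\ j \notin (i |` J)%fset.
  move=> js; have [j0 jJ] : (0 < j)%N /\ j \notin J by apply: sJ; rewrite inE js orbT.
  split=> //; rewrite !inE negb_or jJ andbT.
  by apply: contraNneq is_ => <-.
have mset C : measurable C -> forall j, measurable (set_at B i C j).
  by move=> mC j; rewrite /set_at; case: ifP.
have mhs (b : R) : measurable_fun setT (fun x : R => h (x + b)).
  by apply: measurableT_comp => //; exact: measurable_funD.
have step (b : R) : mean P (fun w => \1_(cylinder J B `&` X i @^-1` [set b]) w *
      h (\sum_(j <- s) X j w * c j + b * c i)) =
    fine (P (cylinder J B)) * fine (P (X i @^-1` [set b])) *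
    bernoulli_mean [seq (q j, c j) | j <- s] (fun x : R => h (x + b * c i)).
  have mb : measurable [set b] by exact: measurable_set1.
  rewrite -cylinderU//.
  rewrite (IH _ _ (fun x : R => h (x + b * c i)) us sJ1 J1 (mset _ mb))//.
  congr (_ * _); rewrite cylinderU// cylinder_indep// fineM//.
  - by apply: fin_num_measure; exact: measurable_cylinder.
  - by apply: fin_num_measure; exact: measurable_preimage_var.
have mcyl (b : R) : measurable (cylinder J B `&` X i @^-1` [set b]).
  by apply: measurableI; [exact: measurable_cylinder|exact: measurable_preimage_var].
have mhS (b : R) : measurable_fun setT
    (fun w => h (\sum_(j <- s) X j w * c j + b * c i)).
  exact: (measurableT_comp (mhs (b * c i)) (measurable_var_sum s)).
have int (b : R) := integrable_indic_mul (mcyl b) (mhS b) (fun w => hM _).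
transitivity (mean P (fun w =>
    \1_(cylinder J B `&` X i @^-1` [set 0]) w *
      h (\sum_(j <- s) X j w * c j + 0 * c i) +
    \1_(cylinder J B `&` X i @^-1` [set 1]) w *
      h (\sum_(j <- s) X j w * c j + 1 * c i))).
  rewrite /mean /Rintegral; congr fine; apply: ae_eq_integral => //.
  - apply/measurable_EFinP; apply: measurable_funM.
      exact/measurable_indic/measurable_cylinder.
    exact: (measurableT_comp mh (measurable_var_sum (i :: s))).
  - apply/measurable_EFinP; apply: measurable_funD.
      apply: measurable_funM; first exact/measurable_indic/mcyl.
      exact: mhS.
    apply: measurable_funM; first exact/measurable_indic/mcyl.
    exact: mhS.
  - have := var_ae01 i0; apply: filterS => w X01 _; congr (_%:E).
    rewrite big_cons !indicE !in_setI.
    have in0 b : (w \in X i @^-1` [set b]) = (X i w == b).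
      by apply/idP/eqP; [rewrite inE|move=> <-; rewrite inE].
    rewrite !in0; case: X01 => ->.
      by rewrite eqxx (eq_sym 0) oner_eq0 andbT andbF !mul0r add0r !addr0.
    by rewrite eqxx oner_eq0 andbT andbF mul0r add0r (addrC (1 * _)).
rewrite (meanD (int 0) (int 1)) !step X_law0// X_law1//= mul0r mul1r.
under [fun x => h (x + 0)]eq_fun do rewrite addr0.
by rewrite -!mulrA -mulrDr.
Qed.

Theorem mean_bernoulli_sum (s : seq nat) (h : R -> R) (M : R) :
  uniq s -> (forall i, i \in s -> (0 < i)%N) ->
  measurable_fun setT h -> (forall x, `|h x| <= M) ->
  mean P (fun w => h (\sum_(i <- s) X i w * c i)) =
  bernoulli_mean [seq (q i, c i) | i <- s] h.
Proof.
move=> us s0 mh hM.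
have cylT : cylinder fset0 (fun=> setT) = setT.
  by rewrite /cylinder -subTset => w _ j.
have := @mean_cylinder_sum s fset0 (fun=> setT) h M us _ _ _ mh hM.
rewrite cylT probability_setT/= mul1r => <-.
- by congr (mean P); apply/funext => w; rewrite indicT mul1r.
- by move=> i /s0.
- by move=> j /=; rewrite inE.
- by move=> j; exact: measurableT.
Qed.

End bernoulli_variables.

(** * The contraction argument *)

Section contraction.
Context {R : realType}.

(** Such functions become constant in the limit, and they are bounded, so dominated
    convergence applies even to a variable [Y] without a mean. *)
Lemma cvg_mean_half_smooth d (T : measurableType d) (P : probability T R)
    (Y : T -> R) (M L : R) (h_ h1_ : nat -> R -> R) :
  measurable_fun setT Y ->
  (forall k, smooth_test M (L / 2 ^+ k) (h_ k) (h1_ k)) ->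
  (fun k => mean P (fun w => h_ k (Y w)) - h_ k 0) @ \oo --> 0.
Proof.
move=> mY hk.
have mh k : measurable_fun setT (h_ k).
  by apply: continuous_measurable_fun; exact: (smooth_test_continuous (hk k)).1.
have hM k x : `|h_ k x| <= M by case: (hk k).
have mg k : measurable_fun setT (fun w => h_ k (Y w)) by exact: measurableT_comp.
rewrite (_ : (fun k => _) = (fun k => mean P (fun w => h_ k (Y w) - h_ k 0))); last first.
  apply/funext => k; rewrite meanB ?mean_cst//.
  - exact: (@bounded_integrable_prob _ _ _ _ _ M).
  - exact: (@bounded_integrable_prob _ _ _ _ _ M).
rewrite -[X in _ --> X](mean_cst P 0).
apply: (@bounded_mean_cvg _ _ _ _ _ _ (M + M)).
- by move=> k; apply: measurable_funB => //; exact: measurable_cst.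
- exact: measurable_cst.
- by move=> k w; rewrite (le_trans (ler_normB _ _))// lerD.
- by move=> w; rewrite normr0 addr_ge0// (le_trans _ (hM 0%N 0)).
- move=> w; apply/cvgrPdist_le => e e0.
  have : (fun k => 2^-1 ^+ k * (L * `|Y w|)) @ \oo --> 0.
    rewrite -[X in _ --> X](mul0r (L * `|Y w|)); apply: cvgM; last exact: cvg_cst.
    by apply: cvg_expr; rewrite ger0_norm ?invr_ge0// invf_lt1// ltr1n.
  move=> /cvgrPdist_le/(_ e e0); apply: filterS => k.
  rewrite !sub0r !normrN => /(le_trans _); apply.
  have [_ hd hL _] := hk k.
  rewrite (le_trans (lipschitz_of_derive hd hL (Y w) 0))// subr0.
  by rewrite (le_trans _ (ler_norm _))// exprVn mulrA (mulrC L).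
Qed.

Lemma iter_dickman_mean (M L : R) h h1 k : smooth_test M L h h1 ->
  exists g1, smooth_test M (L / 2 ^+ k) (iter k (@dickman_mean R) h) g1.
Proof.
move=> st; elim: k => [|k [g1 IH]].
  by exists h1; rewrite expr0 divr1.
exists (dickman_mean' g1) => /=; rewrite exprSr invfM mulrA.
exact: smooth_test_dickman_mean.
Qed.

(** Each application of the averaging operator costs [eps] times the current
    Lipschitz constant on the side of [S] and nothing on the side of [Z]. The
    constants halve each time, and what remains after [k] steps tends to 0. *)
Theorem dickman_contraction d d' (T : measurableType d) (T' : measurableType d')
    (P : probability T R) (Q : probability T' R) (S : T -> R) (Z : T' -> R)
    (eps : R) :
  measurable_fun setT S -> measurable_fun setT Z ->
  (forall M L h h1, smooth_test M L h h1 ->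
     `|mean P (fun w => h (S w)) - mean P (fun w => dickman_mean h (S w))| <= L * eps) ->
  (forall M L h h1, smooth_test M L h h1 ->
     mean Q (fun w => h (Z w)) = mean Q (fun w => dickman_mean h (Z w))) ->
  forall M L h h1, smooth_test M L h h1 ->
  `|mean P (fun w => h (S w)) - mean Q (fun w => h (Z w))| <= 2 * L * eps.
Proof.
move=> mS mZ Sstep Zfix M L h h1 st.
pose hk k := iter k (@dickman_mean R) h.
have /choice[h1k stk] : forall k, exists g1, smooth_test M (L / 2 ^+ k) (hk k) g1.
  by move=> k; exact: iter_dickman_mean st.
pose D k := mean P (fun w => hk k (S w)) - mean Q (fun w => hk k (Z w)).
have Lep : 0 <= L * eps by exact: le_trans (Sstep _ _ _ _ st).
have telescope k : `|D 0%N| <= 2 * (L * eps) * (1 - (2 ^+ k)^-1) + `|D k|.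
  elim: k => [|k IH]; first by rewrite expr0 invr1 subrr mulr0 add0r.
  apply: (le_trans IH).
  have := Sstep _ _ _ _ (stk k).
  rewrite /D (Zfix _ _ _ _ (stk k)) -/(hk k.+1) => H.
  have {}H := le_trans (ler_distD (mean P (fun w => hk k.+1 (S w))) _ _) (lerD H (lexx _)).
  rewrite (le_trans (lerD (lexx _) (H _)))// addrA lerD2r.
  rewrite exprS le_eqVlt; apply/orP; left; apply/eqP; field.
  by rewrite expf_neq0.
have D0 : D @ \oo --> 0.
  have cS := cvg_mean_half_smooth P mS stk; have cZ := cvg_mean_half_smooth Q mZ stk.
  rewrite (_ : D = fun k => (mean P (fun w => hk k (S w)) - hk k 0) -
      (mean Q (fun w => hk k (Z w)) - hk k 0)).
    by rewrite -[X in _ --> X](subrr 0); apply: cvgB.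
  by apply/funext => k; rewrite /D opprB addrA subrK.
apply/ler_addgt0Pr => e e0.
have [k _ /(_ k (leqnn k))] : \forall k \near \oo, `|D k| <= e.
  by move/cvgrPdist_le: D0 => /(_ e e0); apply: filterS => k; rewrite sub0r normrN.
move=> Dk; apply: (le_trans (telescope k)); rewrite lerD//.
by rewrite -(mulrA 2 L) ler_piMr ?(mulr_ge0 _ Lep)// lerBlDr lerDl invr_ge0.
Qed.

End contraction.

(** * The distance between the sum over the primes and the Dickman law *)

Section test_functions.
Context {R : realType}.

Lemma sup_norm_le1 (f : R -> R) : (sup_norm f <= 1)%E -> forall x, `|f x| <= 1.
Proof.
move=> f1 x; rewrite -lee_fin; apply: le_trans f1.
by apply: ereal_sup_ubound; exists x.
Qed.

Lemma W3_test_smooth (h : R -> R) : W3_test h -> smooth_test 1 1 h (h^`(1)%classic).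
Proof.
move=> [[hd _] hn].
have dn k : (k < 3)%N -> forall x : R,
    is_derive x 1 (h^`(k)%classic) (h^`(k.+1)%classic x).
  move=> k3 x; rewrite derive1nS derive1E.
  by apply: DeriveDef => //; exact: hd.
have bn k : (k <= 3)%N -> forall x, `|h^`(k)%classic x| <= 1.
  by move=> k3; apply: sup_norm_le1; exact: hn.
split.
- exact: (bn 0%N).
- exact: (dn 0%N).
- exact: (bn 1%N).
- exact: (lipschitz_of_derive (dn 1%N isT) (bn 2%N isT)).
Qed.

Lemma W3_test0 : W3_test (fun=> 0 : R).
Proof.
have d0 k : (fun=> 0 : R)^`(k)%classic = (fun=> 0 : R).
  by elim: k => // k IH; rewrite derive1nS IH; apply/funext => x; rewrite derive1_cst.
split; first split.
- by move=> k _ x; rewrite d0; exact: derivable_cst.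
- by rewrite d0; exact: cst_continuous.
- move=> k _; rewrite d0; apply: ge_ereal_sup => _ [x _ <-].
  by rewrite normr0 lee_fin.
Qed.

Context d d' (T : measurableType d) (T' : measurableType d')
  (P : probability T R) (Q : probability T' R) (X : T -> R) (Y : T' -> R).
Hypothesis mX : measurable_fun setT X.
Hypothesis mY : measurable_fun setT Y.

Lemma expectation_mean d1 (T1 : measurableType d1) (P1 : probability T1 R)
    (f : T1 -> R) (M : R) : measurable_fun setT f -> (forall w, `|f w| <= M) ->
  'E_P1[f]%E = (mean P1 f)%:E.
Proof.
move=> mf fM; rewrite unlock /mean /Rintegral fineK//.
by apply: integrable_fin_num => //; exact: (@bounded_integrable_prob _ _ _ _ _ M).
Qed.

Lemma W3_le (e : R) :
  (forall h h1, smooth_test 1 1 h h1 ->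
     `|mean P (fun w => h (X w)) - mean Q (fun w => h (Y w))| <= e) ->
  (W3 P Q X Y <= e%:E)%E.
Proof.
move=> he; apply: ge_ereal_sup => _ [h /W3_test_smooth st <-].
have [ch _] := smooth_test_continuous st.
have mh : measurable_fun setT h by exact: continuous_measurable_fun.
have hM : forall x, `|h x| <= 1 by case: st.
rewrite (expectation_mean P (measurableT_comp mh mX) (fun w => hM _)).
rewrite (expectation_mean Q (measurableT_comp mh mY) (fun w => hM _)).
by rewrite -EFinB abse_EFin lee_fin; exact: he st.
Qed.

Lemma W3_ge0 : (0 <= W3 P Q X Y)%E.
Proof.
apply: le_trans (ereal_sup_ubound _); last by exists (fun=> 0); [exact: W3_test0|].
exact: abse_ge0.
Qed.

End test_functions.

Section prime_enumeration.
Variable p : nat -> nat.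
Hypothesis p_enum : prime_enumeration p.

Lemma prime_enum_prime j : (0 < j)%N -> prime (p j).
Proof. by move=> j0; apply/(p_enum.2 (p j)); exists j. Qed.

Lemma prime_enum_le i j : (0 < i)%N -> (i <= j)%N -> (p i <= p j)%N.
Proof.
move=> i0; rewrite leq_eqVlt => /predU1P[->//|ij]; apply: ltnW.
exact: p_enum.1.
Qed.

Lemma prime_enum_gt j : (0 < j)%N -> (j < p j)%N.
Proof.
elim: j => [//|[|j] IH] _; first exact/prime_gt1/prime_enum_prime.
by apply: (leq_ltn_trans (IH isT)); apply: p_enum.1.
Qed.

(** An initial segment of the enumeration lists the primes up to its last term. *)
Lemma prime_enum_sum (R : realType) (F : nat -> R) j : (0 < j)%N ->
  \sum_(1 <= i < j.+1) F (p i) = \sum_(0 <= q < (p j).+1 | prime q) F q.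
Proof.
move=> j0; rewrite -[RHS]big_filter -(big_map p xpredT); apply: perm_big.
apply: uniq_perm.
- rewrite map_inj_in_uniq ?iota_uniq// => i k.
  rewrite !mem_index_iota => /andP[i0 _] /andP[k0 _] pik.
  have [ik|ki|//] := ltngtP i k.
    by have := p_enum.1 _ _ i0 ik; rewrite pik ltnn.
  by have := p_enum.1 _ _ k0 ki; rewrite pik ltnn.
- by rewrite filter_uniq// iota_uniq.
- move=> x; rewrite mem_filter mem_index_iota/= ltnS.
  apply/mapP/andP => [[i im ->]|[px xj]].
    move: im; rewrite mem_index_iota ltnS => /andP[i0 ij].
    by rewrite prime_enum_prime// prime_enum_le.
  have [i i0 pi] := (p_enum.2 x).1 px; exists i => //.
  rewrite mem_index_iota i0 ltnS/= leqNgt; apply/negP => ji.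
  by move: xj; rewrite -pi leqNgt p_enum.1.
Qed.

End prime_enumeration.

Section prime_sum_bound.
Context (R : realType) (d d' : measure_display)
    (T : measurableType d) (T' : measurableType d')
    (P : probability T R) (Q : probability T' R)
    (p : nat -> nat) (X : nat -> {RV P >-> R}) (Z : {RV Q >-> R}).
Hypotheses (p_enum : prime_enumeration p)
    (X_indep : mutually_independent [set j | (0 < j)%N] X)
    (X_law0 : forall j, (0 < j)%N ->
       P (X j @^-1` [set 0]) = ((p j)%:R / (1 + (p j)%:R))%:E)
    (X_law1 : forall j, (0 < j)%N ->
       P (X j @^-1` [set 1]) = (1 / (1 + (p j)%:R))%:E)
    (Z_dickman : dickman Z).

Variable n : nat.
Hypothesis n2 : (2 <= n)%N.

Let q (i : nat) : R := 1 / (1 + (p i)%:R).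
(* The Riemann sum starts at the origin, whatever the value of p 0. *)
Let a (i : nat) : R := if i == 0%N then 0 else ln (p i)%:R / ln (p n)%:R.
Let n0 : (0 < n)%N. Proof. exact: ltnW. Qed.

Let lnpn_gt0 : 0 < ln (p n)%:R :> R.
Proof. exact/lnn_prime_gt0/prime_enum_prime. Qed.

Let aE i : (0 < i)%N -> a i = ln (p i)%:R / ln (p n)%:R.
Proof. by rewrite /a; case: i. Qed.

Let p_gt0 i : (0 < i)%N -> (0 < p i)%N.
Proof. by move=> i0; apply/prime_gt0/prime_enum_prime. Qed.

Let a_incr i : a i <= a i.+1.
Proof.
rewrite /a/=; case: eqP => [_|/eqP i0]; first by rewrite divr_ge0 ?lnn_ge0.
have {}i0 : (0 < i)%N by rewrite lt0n.
by rewrite ler_wpM2r ?invr_ge0 ?lnn_ge0// ler_lnn ?p_gt0// prime_enum_le.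
Qed.

Let q_prob i : is_prob (q i).
Proof.
have p0 : 0 <= (p i)%:R :> R by [].
rewrite /is_prob /q divr_ge0 ?addr_ge0//= ler_pdivrMr; lra.
Qed.

Let sum_qa j : (0 < j)%N -> \sum_(1 <= i < j.+1) q i * a i =
  (ln (p n)%:R)^-1 * \sum_(0 <= r < (p j).+1 | prime r) ln r%:R / (1 + r%:R).
Proof.
move=> j0; rewrite -(prime_enum_sum p_enum (fun r => ln r%:R / (1 + r%:R)) j0).
rewrite mulr_sumr big_nat_cond [RHS]big_nat_cond.
apply: eq_bigr => i /andP[/andP[i0 _] _]; rewrite aE// /q; ring.
Qed.

Let delta : R := 5 / ln (p n)%:R.

Let weight_le i : (i <= n)%N -> q i * a i <= delta.
Proof.
have d0 : 0 <= delta by rewrite /delta divr_ge0// ltW.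
move=> _; case: i => [|i]; first by rewrite /a eqxx mulr0.
rewrite aE// mulrA /delta ler_wpM2r ?invr_ge0 ?(ltW lnpn_gt0)//.
have pi0 : 0 < (p i.+1)%:R :> R by rewrite ltr0n p_gt0.
have := ln_sublinear pi0; rewrite /q mul1r mulrC ler_pdivrMr; lra.
Qed.

Let discrepancy_le j : (j <= n)%N ->
  `|\sum_(1 <= i < j.+1) q i * a i - a j| <= delta.
Proof.
move=> _; case: j => [|j].
  by rewrite big_geq// /a eqxx subrr normr0 /delta divr_ge0// ltW.
rewrite sum_qa// aE// (mulrC (ln (p j.+1)%:R)) -mulrBr normrM normfV.
rewrite (gtr0_norm lnpn_gt0) mulrC /delta ler_wpM2r ?invr_ge0 ?(ltW lnpn_gt0)//.
exact/mertens_first/p_gt0.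
Qed.

Let sum_sqr_le : \sum_(1 <= i < n.+1) (q i * a i) ^+ 2 <= 2 / ln (p n)%:R.
Proof.
apply: (@le_trans _ _ ((ln (p n)%:R)^-1 *
   \sum_(0 <= r < (p n).+1 | prime r) ln r%:R / (r%:R ^+ 2 - 1))); last first.
  by rewrite mulrC ler_wpM2r ?invr_ge0 ?(ltW lnpn_gt0)// sum_ln_div_sqr_le.
rewrite -(prime_enum_sum p_enum (fun r => ln r%:R / (r%:R ^+ 2 - 1)) n0) mulr_sumr.
rewrite big_nat_cond [leRHS]big_nat_cond; apply: ler_sum => i /andP[/andP[i0 ni] _].
have p1 : 1 < (p i)%:R :> R by rewrite ltr1n prime_gt1// prime_enum_prime.
have p2 : 1 < (p i)%:R ^+ 2 :> R by rewrite exprn_egt1.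
have a0 : 0 <= a i by rewrite aE// divr_ge0 ?lnn_ge0.
have a1 : a i <= 1.
  by rewrite aE// ler_pdivrMr// mul1r ler_lnn ?p_gt0// prime_enum_le.
rewrite exprMn (_ : _ * (_ / _) = ((p i)%:R ^+ 2 - 1)^-1 * a i); last first.
  by rewrite aE//; ring.
rewrite ler_pM ?sqr_ge0//.
  by rewrite /q mul1r exprVn lef_pV2 ?posrE ?exprn_gt0 ?subr_gt0//; nra.
by rewrite expr2 ler_piMr.
Qed.

Let measurable_prime_sum : measurable_fun setT (prime_sum p X n).
Proof.
apply: measurable_funM => //; apply: measurable_sum => i.
exact: measurable_funM.
Qed.

(** With [a i = ln (p i) / ln (p n)] and [q i = 1 / (1 + p i)], Mertens' theorem says
    that the cumulative sums of [q i * a i] are within [5 / ln (p n)] of the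
    [a i]. The squares of the weights add up to at most [2 / ln (p n)], so the
    comparison costs [(2 + 5 * 5) / 2] over [ln (p n)] for functions with
    constant 1, and the contraction doubles this. *)
Lemma W3_prime_sum_le : (W3 P Q (prime_sum p X n) Z <= (27 / ln n%:R)%:E)%E.
Proof.
have mZ : measurable_fun setT (Z : T' -> R) by exact: measurable_funP.
have lnn0 : 0 < ln n%:R :> R by rewrite ln_gt0// ltr1n.
apply: (@le_trans _ _ (27 / ln (p n)%:R)%:E); last first.
  rewrite lee_fin ler_wpM2l// lef_pV2 ?posrE// ler_lnn//.
  exact/ltnW/prime_enum_gt.
apply: (W3_le measurable_prime_sum mZ) => h h1 st.
have -> : 27 / ln (p n)%:R = 2 * 1 * (27 / 2 / ln (p n)%:R) :> R.
  by field; rewrite gt_eqF.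
apply: (@dickman_contraction _ _ _ _ _ P Q _ Z _ _ mZ _ _ _ _ _ _ st);
  first exact: measurable_prime_sum; last first.
  move=> {h h1 st} M L h h1 [hM hd hL _].
  exact: (dickman_fixed_point Z_dickman (lipschitz_of_derive hd hL) hM).
move=> {h h1 st} M L h h1 st.
pose l := [seq (q i, a i) | i <- index_iota 1 n.+1].
have meanE (M' L' : R) g g1 : smooth_test M' L' g g1 ->
    mean P (fun w => g (prime_sum p X n w)) = bernoulli_mean l g.
  move=> stg; have [cg _] := smooth_test_continuous stg.
  rewrite -(@mean_bernoulli_sum _ _ _ _ X q a X_indep _ _ (index_iota 1 n.+1) g M').
  - congr (mean P); apply/funext => w; congr g; rewrite /prime_sum mulr_sumr.
    rewrite big_nat_cond [RHS]big_nat_cond; apply: eq_bigr => i /andP[/andP[i0 _] _].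
    by rewrite aE// mulrCA (mulrC (ln _)).
  - move=> j j0; rewrite X_law0// /q; congr (_%:E).
    have : 0 <= (p j)%:R :> R by [].
    by move=> pj; field; rewrite gt_eqF//; lra.
  - exact: X_law1.
  - exact: iota_uniq.
  - by move=> i; rewrite mem_index_iota => /andP[].
  - exact: continuous_measurable_fun.
  - by case: stg.
rewrite (meanE _ _ _ _ st) (meanE _ _ _ _ (smooth_test_dickman_mean st)).
have an : a n = 1 by rewrite aE// divff// gt_eqF.
have := @dickman_mean_stein_bound _ n a q delta M L h h1 st (erefl _) an a_incr
  q_prob weight_le discrepancy_le l erefl.
move=> /le_trans; apply.
have L0 : 0 <= L by case: st => _ _ /(_ 0) h1L _; exact: le_trans h1L.
rewrite [leRHS](_ : _ = L / 2 * (2 / ln (p n)%:R + 5 * delta)); last first.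
  by rewrite /delta; field; rewrite gt_eqF.
by rewrite ler_wpM2l ?divr_ge0// lerD2r.
Qed.

End prime_sum_bound.

Section delta_estimates.
Context {R : realType}.

(** [exp(1) <= (6/5) ^ 6 < 3], from [exp(-1/6) >= 5/6]. *)
Lemma ln3_gt1 : 1 < ln 3 :> R.
Proof.
rewrite -ltr_expR lnK ?posrE//.
have h : expR (- 6^-1) >= 5 / 6 :> R.
  by rewrite (le_trans _ (expR_ge1Dx _))//; lra.
have -> : expR 1 = expR 6^-1 ^+ 6 :> R by rewrite -expRM_natl; congr expR; field.
have h6 : expR 6^-1 <= 6 / 5 :> R.
  rewrite -[6^-1]opprK expRN -[leRHS]invrK lef_pV2 ?posrE ?expR_gt0//.
  by rewrite (le_trans _ h)//; lra.
apply: (@le_lt_trans _ _ ((6 / 5) ^+ 6)).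
  by rewrite lerXn2r ?nnegrE ?expR_ge0// divr_ge0.
by rewrite !exprS expr0; lra.
Qed.

Lemma lnln3_gt0 : 0 < ln (ln 3) :> R.
Proof. exact/ln_gt0/ln3_gt1. Qed.

Lemma ler_ln3 (n : nat) : (3 <= n)%N -> ln 3 <= ln n%:R :> R.
Proof. by move=> n3; rewrite ler_lnn. Qed.

Lemma ler_lnln3 (n : nat) : (3 <= n)%N -> ln (ln 3) <= ln (ln n%:R) :> R.
Proof.
move=> n3; have l3 := ln3_gt1; have h := ler_ln3 n3.
by rewrite ler_ln ?posrE//; lra.
Qed.

(** With [y = ln (ln n)], [Delta n] is [y * exp(-y)], which is at most [exp(-1)]. *)
Lemma one_le_sqrt_log_Delta (n : nat) : (3 <= n)%N -> 1 <= Num.sqrt (- ln (Delta R n)).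
Proof.
move=> n3; have l3 := ler_lnln3 n3.
have lnn1 : 1 < ln n%:R :> R := lt_le_trans ln3_gt1 (ler_ln3 n3).
rewrite -sqrtr1 ler_wsqrtr// lerNr.
set y := ln (ln n%:R) in l3 *.
have y0 : 0 < y := lt_le_trans lnln3_gt0 l3.
rewrite /Delta -/y -ler_expR lnK ?posrE ?divr_gt0//; last by lra.
have -> : ln n%:R = expR y by rewrite /y lnK// posrE; lra.
rewrite -expRN -ler_pdivlMr ?expR_gt0// -expRN opprK -expRD.
by have := expR_ge1Dx (- 1 + y : R); rewrite addrA subrr add0r.
Qed.

End delta_estimates.

Theorem theorem5 (R : realType) (d d' : measure_display)
    (T : measurableType d) (T' : measurableType d')
    (P : probability T R) (Q : probability T' R)
    (p : nat -> nat) (X : nat -> {RV P >-> R}) (Z : {RV Q >-> R})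
    (p_enum : prime_enumeration p)
    (X_indep : mutually_independent [set j | (0 < j)%N] X)
    (X_law0 : forall j, (0 < j)%N ->
       P (X j @^-1` [set 0]) = ((p j)%:R / (1 + (p j)%:R))%:E)
    (X_law1 : forall j, (0 < j)%N ->
       P (X j @^-1` [set 1]) = (1 / (1 + (p j)%:R))%:E)
    (Z_dickman : dickman Z) :
  (exists C : R, 0 < C /\
     forall n : nat, (3 <= n)%N ->
       (W3 P Q (prime_sum p X n) Z
          <= (C * Delta R n * Num.sqrt (- ln (Delta R n)))%:E)%E)
  /\
  (fun n : nat => fine (W3 P Q (prime_sum p X n) Z) : R)
    =O_\oo (fun n : nat => (ln (ln n%:R) `^ (3 / 2)) / ln n%:R : R).
Proof.
have bound n : (2 <= n)%N ->
    (W3 P Q (prime_sum p X n) Z <= (27 / ln n%:R)%:E)%E.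
  exact: W3_prime_sum_le.
split.
- have l0 := @lnln3_gt0 R.
  exists (27 / ln (ln 3)); split; first by rewrite divr_gt0.
  move=> n n3; apply: (le_trans (bound n (ltnW n3))); rewrite lee_fin.
  have l3 := @ler_lnln3 R n n3.
  have lnn0 : 0 < ln n%:R :> R by rewrite ln_gt0// ltr1n ltnW.
  have D0 : 0 <= Delta R n by rewrite /Delta divr_ge0// ltW// (lt_le_trans l0).
  apply: (@le_trans _ _ (27 / ln (ln 3) * Delta R n)); last first.
    by rewrite ler_peMr ?one_le_sqrt_log_Delta// mulr_ge0// divr_ge0// ltW.
  rewrite /Delta mulrA ler_wpM2r ?invr_ge0 ?(ltW lnn0)//.
  by rewrite -mulrA ler_peMr// ler_pdivlMl// mulr1.
- apply/eqO_exP; exists 27 => //; near=> n.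
  have n2 : (2 <= n)%N by near: n; exact: nbhs_infty_ge.
  have lnn_ge : expR 1 <= ln n%:R :> R.
    have : (Num.truncn (expR (expR 1 : R)) < n)%N by near: n; exact: nbhs_infty_gt.
    move=> tn; rewrite -ler_expR lnK ?posrE ?ltr0n ?(ltnW n2)//.
    by apply/ltW/(lt_le_trans (truncnS_gt _)); rewrite ler_nat.
  have lnn0 : 0 < ln n%:R :> R by apply: lt_le_trans lnn_ge; exact: expR_gt0.
  have lnln1 : 1 <= ln (ln n%:R) :> R by rewrite -ler_expR lnK ?posrE.
  have W_ge0 := W3_ge0 P Q (prime_sum p X n) Z.
  have W_le := bound n n2.
  rewrite ger0_norm ?fine_ge0// ger0_norm; last first.
    by rewrite divr_ge0 ?powR_ge0// ltW.
  apply: (@le_trans _ _ (27 / ln n%:R)).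
    rewrite -lee_fin fineK// ge0_fin_numE//.
    by apply: (le_lt_trans W_le); rewrite ltry.
  rewrite ler_wpM2l// -[leLHS]mul1r ler_wpM2r ?invr_ge0 ?(ltW lnn0)//.
  by rewrite -[leLHS](powRr0 (ln (ln n%:R))) ler_powR// divr_ge0.
Unshelve. all: by end_near. Qed.
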